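(* Let $R$ be a Noetherian ring, $X=\mathrm{Spec}(R)$, and let $\mathcal{M}\subset\mathcal{N}$ be finitely generated $R$-modules. Then for each $n$ $$\mathrm{Ass}_X(\mathcal{N}^{n}/\overline{\mathcal{M}^{n}})\subseteq\mathrm{Ass}_X(\mathcal{N}^{n+1}/\overline{\mathcal{M}^{n+1}}).$$ Furthermore, there exists $n_0$ such that $$\mathrm{Ass}_X(\mathcal{N}^{n_0}/\overline{\mathcal{M}^{n_0}})=\mathrm{Ass}_X(\mathcal{N}^{n_0+k}/\overline{\mathcal{M}^{n_0+k}})$$ for any $k\geq 0$.
   Context: Rees algebra: for a finitely generated $R$-module $\mathcal{M}$, $\mathcal{R}(\mathcal{M}):=\mathrm{Sym}(\mathcal{M})/\bigcap_g\mathcal{L}_g$, where $g$ runs over all homomorphisms from $\mathcal{M}$ to a free $R$-module $\mathcal{F}_g$ and $\mathcal{L}_g$ is the kernel of $\mathrm{Sym}(\mathcal{M})\to\mathrm{Sym}(\mathcal{F}_g)$. The inclusion $\mathcal{M}\subset\mathcal{N}$ induces $\mathcal{R}(\mathcal{M})\to\mathcal{R}(\mathcal{N})$. For $n\ge1$, $\mathcal{N}^n$ is the $n$th graded component of $\mathcal{R}(\mathcal{N})$ and $\mathcal{M}^n$ is the image in $\mathcal{R}(\mathcal{N})$ of the $n$th graded component of $\mathcal{R}(\mathcal{M})$. The integral closure $\overline{\mathcal{M}^n}$ of $\mathcal{M}^n$ in $\mathcal{N}^n$ is the submodule of all $g\in\mathcal{N}^n$ satisfying in $\mathcal{R}(\mathcal{N})$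 an equation $g^u+m_1g^{u-1}+\cdots+m_u=0$ with $u\ge1$ and $m_i\in\mathcal{M}^{ni}$. $\mathrm{Ass}_X(L)$ is the set of points of $X$ whose prime ideals are associated primes of the $R$-module $L$. *)

(* Defs.v *)
From HB Require Import structures.
From mathcomp Require Import all_boot all_algebra.
From mathcomp Require Import generic_quotient ring_quotient.
From mathcomp Require Import boolp classical_sets.

Set Implicit Arguments.
Unset Strict Implicit.
Unset Printing Implicit Defensive.

Import GRing.Theory.
Local Open Scope ring_scope.
Local Open Scope quotient_scope.
Local Open Scope classical_set_scope.

(* Rings are commutative with 1 and may be zero ([comPzRingType]).  Ideals and *)
(* submodules are not assumed decidable, hence [set] rather than [{pred _}].   *)

Section NoetherianRings.
Variable R : comPzRingType.

Definition is_ideal (I : set R) : Prop :=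
  [/\ I 0, forall x y, I x -> I y -> I (x + y) & forall a x, I x -> I (a * x)].

Definition is_prime_ideal (I : set R) : Prop :=
  [/\ is_ideal I, ~ I 1 & forall x y, I (x * y) -> I x \/ I y].

Definition noetherian : Prop :=
  forall I : set R, is_ideal I ->
    exists (n : nat) (a : 'I_n -> R),
      I = [set x | exists c : 'I_n -> R, x = \sum_(i < n) c i * a i].

Record spec : Type := Spec {
  spec_ideal :> set R;
  spec_prime : is_prime_ideal spec_ideal
}.

End NoetherianRings.

Section Modules.
Variables (R : comPzRingType) (V : lmodType R).

Definition fin_gen : Prop :=
  exists (n : nat) (v : 'I_n -> V),
    forall x : V, exists c : 'I_n -> R, x = \sum_(i < n) c i *: v i.

Definition is_basis (B : set V) : Prop :=
  (forall x : V, exists (s : seq V) (c : V -> R),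
     (forall b, b \in s -> B b) /\ x = \sum_(b <- s) c b *: b) /\
  (forall (s : seq V) (c : V -> R),
     uniq s -> (forall b, b \in s -> B b) ->
     \sum_(b <- s) c b *: b = 0 -> forall b, b \in s -> c b = 0).

Definition free_module : Prop := exists B : set V, is_basis B.

(* Associated primes of the R-module A / B, for submodules B <= A of V; the    *)
(* annihilator of the class x + B is {a | a x in B}.                           *)
Definition Ass_quot (A B : set V) : set (spec R) :=
  [set p | exists2 x, A x & (p : set R) = [set a | B (a *: x)]].

End Modules.

(* The symmetric algebra of V as the commutative R-algebra presented by the   *)
(* generators [SVar x], x in V, and the relations making x |-> SVar x linear. *)
Section SymmetricAlgebra.
Variables (R : comPzRingType) (V : lmodType R).

Inductive sym_expr : Type :=
  | SCst of R
  | SVar of V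
  | SOpp of sym_expr
  | SAdd of sym_expr & sym_expr
  | SMul of sym_expr & sym_expr.

Inductive sym_eq : sym_expr -> sym_expr -> Prop :=
  | sym_refl e : sym_eq e e
  | sym_sym e f : sym_eq e f -> sym_eq f e
  | sym_trans e f h : sym_eq e f -> sym_eq f h -> sym_eq e h
  | sym_congN e e' : sym_eq e e' -> sym_eq (SOpp e) (SOpp e')
  | sym_congD e e' f f' :
      sym_eq e e' -> sym_eq f f' -> sym_eq (SAdd e f) (SAdd e' f')
  | sym_congM e e' f f' :
      sym_eq e e' -> sym_eq f f' -> sym_eq (SMul e f) (SMul e' f')
  | sym_addA e f h : sym_eq (SAdd e (SAdd f h)) (SAdd (SAdd e f) h)
  | sym_addC e f : sym_eq (SAdd e f) (SAdd f e)
  | sym_add0 e : sym_eq (SAdd (SCst 0) e) e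
  | sym_addN e : sym_eq (SAdd (SOpp e) e) (SCst 0)
  | sym_mulA e f h : sym_eq (SMul e (SMul f h)) (SMul (SMul e f) h)
  | sym_mulC e f : sym_eq (SMul e f) (SMul f e)
  | sym_mul1 e : sym_eq (SMul (SCst 1) e) e
  | sym_mulDl e f h :
      sym_eq (SMul (SAdd e f) h) (SAdd (SMul e h) (SMul f h))
  | sym_cstD a b : sym_eq (SCst (a + b)) (SAdd (SCst a) (SCst b))
  | sym_cstM a b : sym_eq (SCst (a * b)) (SMul (SCst a) (SCst b))
  | sym_varD x y : sym_eq (SVar (x + y)) (SAdd (SVar x) (SVar y))
  | sym_varZ a x : sym_eq (SVar (a *: x)) (SMul (SCst a) (SVar x)).

HB.instance Definition _ := gen_eqMixin sym_expr.
HB.instance Definition _ := gen_choiceMixin sym_expr.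

Definition sym_rel (e f : sym_expr) : bool := `[< sym_eq e f >].

Lemma sym_rel_equiv : equiv_class_of sym_rel.
Proof.
split=> [e|e f|f e h].
- by apply/asboolP; apply: sym_refl.
- by apply/asboolP/asboolP; apply: sym_sym.
- by move=> /asboolP ef /asboolP fh; apply/asboolP; apply: sym_trans ef fh.
Qed.

Canonical sym_rel_equivRel := EquivRelPack sym_rel_equiv.
Canonical sym_rel_encModRel := defaultEncModRel sym_rel.

Definition sym : Type := {eq_quot sym_rel}.
HB.instance Definition _ := Choice.on sym.
HB.instance Definition _ : EqQuotient sym_expr sym_rel sym := EqQuotient.on sym.

Definition sym_pi (e : sym_expr) : sym := \pi_sym e.

Lemma sym_piP e f : sym_pi e = sym_pi f <-> sym_eq e f.
Proof.
by split=> [/eqmodP/asboolP|ef]; last by apply/eqmodP; apply/asboolP.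
Qed.

Lemma sym_reprK (x : sym) : sym_pi (repr x) = x.
Proof. exact: reprK. Qed.

Lemma sym_repr_pi e : sym_eq (repr (sym_pi e)) e.
Proof. by apply/sym_piP; rewrite sym_reprK. Qed.

Definition sym_add (x y : sym) : sym := sym_pi (SAdd (repr x) (repr y)).
Definition sym_mul (x y : sym) : sym := sym_pi (SMul (repr x) (repr y)).
Definition sym_opp (x : sym) : sym := sym_pi (SOpp (repr x)).

Lemma sym_addE e f : sym_add (sym_pi e) (sym_pi f) = sym_pi (SAdd e f).
Proof. by apply/sym_piP; apply: sym_congD; apply: sym_repr_pi. Qed.

Lemma sym_mulE e f : sym_mul (sym_pi e) (sym_pi f) = sym_pi (SMul e f).
Proof. by apply/sym_piP; apply: sym_congM; apply: sym_repr_pi. Qed.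

Lemma sym_ind_pi (P : sym -> Prop) : (forall e, P (sym_pi e)) -> forall x, P x.
Proof. by move=> H x; rewrite -[x]sym_reprK. Qed.

Fact sym_addrA : associative sym_add.
Proof.
elim/sym_ind_pi=> e; elim/sym_ind_pi=> f; elim/sym_ind_pi=> h.
by rewrite !sym_addE; apply/sym_piP; apply: sym_addA.
Qed.

Fact sym_addrC : commutative sym_add.
Proof.
elim/sym_ind_pi=> e; elim/sym_ind_pi=> f.
by rewrite !sym_addE; apply/sym_piP; apply: sym_addC.
Qed.

Fact sym_add0r : left_id (sym_pi (SCst 0)) sym_add.
Proof.
by elim/sym_ind_pi=> e; rewrite sym_addE; apply/sym_piP; apply: sym_add0.
Qed.

Fact sym_mulrA : associative sym_mul.
Proof.
elim/sym_ind_pi=> e; elim/sym_ind_pi=> f; elim/sym_ind_pi=> h.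
by rewrite !sym_mulE; apply/sym_piP; apply: sym_mulA.
Qed.

Fact sym_mulrC : commutative sym_mul.
Proof.
elim/sym_ind_pi=> e; elim/sym_ind_pi=> f.
by rewrite !sym_mulE; apply/sym_piP; apply: sym_mulC.
Qed.

Fact sym_mul1r : left_id (sym_pi (SCst 1)) sym_mul.
Proof.
by elim/sym_ind_pi=> e; rewrite sym_mulE; apply/sym_piP; apply: sym_mul1.
Qed.

Fact sym_mulrDl : left_distributive sym_mul sym_add.
Proof.
elim/sym_ind_pi=> e; elim/sym_ind_pi=> f; elim/sym_ind_pi=> h.
rewrite sym_addE !sym_mulE sym_addE.
by apply/sym_piP; apply: sym_mulDl.
Qed.

Lemma sym_oppE e : sym_opp (sym_pi e) = sym_pi (SOpp e).
Proof. by apply/sym_piP; apply: sym_congN; apply: sym_repr_pi. Qed.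

Fact sym_addNr : left_inverse (sym_pi (SCst 0)) sym_opp sym_add.
Proof.
elim/sym_ind_pi=> e; rewrite sym_oppE sym_addE.
by apply/sym_piP; apply: sym_addN.
Qed.

HB.instance Definition _ :=
  GRing.isZmodule.Build sym sym_addrA sym_addrC sym_add0r sym_addNr.
HB.instance Definition _ :=
  GRing.Zmodule_isComPzRing.Build sym sym_mulrA sym_mulrC sym_mul1r sym_mulrDl.

Definition sym_cst (a : R) : sym := sym_pi (SCst a).

Lemma sym_cst1 : sym_cst 1 = 1. Proof. by []. Qed.

Lemma sym_cstrD : {morph sym_cst : a b / a + b}.
Proof.
move=> a b; rewrite [RHS](sym_addE (SCst a) (SCst b)).
by apply/sym_piP; apply: sym_cstD.
Qed.

Lemma sym_cstrM : {morph sym_cst : a b / a * b}.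
Proof.
move=> a b; rewrite [RHS](sym_mulE (SCst a) (SCst b)).
by apply/sym_piP; apply: sym_cstM.
Qed.

Definition sym_scale (a : R) (x : sym) : sym := sym_cst a * x.

Fact sym_scaleA a b x : sym_scale a (sym_scale b x) = sym_scale (a * b) x.
Proof. by rewrite /sym_scale sym_cstrM mulrA. Qed.

Fact sym_scale1 : left_id 1 sym_scale.
Proof. by move=> x; rewrite /sym_scale sym_cst1 mul1r. Qed.

Fact sym_scaleDr : right_distributive sym_scale +%R.
Proof. by move=> a x y; rewrite /sym_scale mulrDr. Qed.

Fact sym_scaleDl x : {morph sym_scale^~ x : a b / a + b}.
Proof. by move=> a b; rewrite /sym_scale sym_cstrD mulrDl. Qed.

HB.instance Definition _ := GRing.Zmodule_isLmodule.Build R sym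
  sym_scaleA sym_scale1 sym_scaleDr sym_scaleDl.

Lemma sym_scaleE a (x : sym) : a *: x = sym_cst a * x. Proof. by []. Qed.

Definition sym_var (x : V) : sym := sym_pi (SVar x).

Lemma sym_var_linear : linear sym_var.
Proof.
move=> a x y; rewrite sym_scaleE.
rewrite [_ * _](sym_mulE (SCst a) (SVar x)) [RHS]sym_addE.
apply/sym_piP; apply: sym_trans (sym_varD _ _) _.
by apply: sym_congD; [apply: sym_varZ | apply: sym_refl].
Qed.

HB.instance Definition _ :=
  GRing.isLinear.Build R V sym *:%R sym_var sym_var_linear.

(* The n-th graded component: the R-span of the products of n elements of V. *)
Definition sym_deg (n : nat) : set sym :=
  [set s | exists (k : nat) (c : 'I_k -> R) (v : 'I_k -> 'I_n -> V),
     s = \sum_(i < k) c i *: \prod_(j < n) sym_var (v i j)].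

End SymmetricAlgebra.
Arguments sym_deg {R} V n.

Section SymMap.
Variables (R : comPzRingType) (U V : lmodType R) (f : {linear U -> V}).

Fixpoint sym_expr_map (e : sym_expr U) : sym_expr V :=
  match e with
  | SCst a => SCst V a
  | SVar x => SVar (f x)
  | SOpp e => SOpp (sym_expr_map e)
  | SAdd e1 e2 => SAdd (sym_expr_map e1) (sym_expr_map e2)
  | SMul e1 e2 => SMul (sym_expr_map e1) (sym_expr_map e2)
  end.

Lemma sym_expr_map_eq e e' :
  sym_eq e e' -> sym_eq (sym_expr_map e) (sym_expr_map e').
Proof.
elim=> /= *; rewrite ?linearD ?linearZ; by [eauto using sym_eq].
Qed.

Definition sym_map (x : sym U) : sym V := sym_pi (sym_expr_map (repr x)).

Lemma sym_mapE e : sym_map (sym_pi e) = sym_pi (sym_expr_map e).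
Proof. by apply/sym_piP; apply: sym_expr_map_eq; apply: sym_repr_pi. Qed.

Lemma sym_map_zmod : zmod_morphism sym_map.
Proof.
elim/sym_ind_pi=> e; elim/sym_ind_pi=> e'.
have subE (W : lmodType R) (h h' : sym_expr W) :
    sym_pi h - sym_pi h' = sym_pi (SAdd h (SOpp h')).
  by rewrite -[RHS]sym_addE -sym_oppE.
by rewrite subE !sym_mapE subE.
Qed.

Lemma sym_map_monoid : monoid_morphism sym_map.
Proof.
split; first exact: (sym_mapE (SCst U 1)).
elim/sym_ind_pi=> e; elim/sym_ind_pi=> e'.
by rewrite [X in sym_map X]sym_mulE !sym_mapE [RHS]sym_mulE.
Qed.

HB.instance Definition _ :=
  GRing.isZmodMorphism.Build (sym U) (sym V) sym_map sym_map_zmod.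
HB.instance Definition _ :=
  GRing.isMonoidMorphism.Build (sym U) (sym V) sym_map sym_map_monoid.

Lemma sym_map_var x : sym_map (sym_var x) = sym_var (f x).
Proof. exact: sym_mapE. Qed.

Lemma sym_map_scalable : scalable sym_map.
Proof.
move=> a x; rewrite !sym_scaleE rmorphM /=.
by congr (_ * _); apply: sym_mapE.
Qed.

HB.instance Definition _ :=
  GRing.isScalable.Build R (sym U) (sym V) *:%R sym_map sym_map_scalable.

End SymMap.

Lemma sym_map_comp (R : comPzRingType) (U V W : lmodType R)
    (g : {linear V -> W}) (f : {linear U -> V}) (x : sym U) :
  sym_map (g \o f) x = sym_map g (sym_map f x).
Proof.
elim/sym_ind_pi: x => e; rewrite !sym_mapE; congr sym_pi.
by elim: e => //= [e ->|e -> e' ->|e -> e' ->].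
Qed.

Section ReesAlgebra.
Variables (R : comPzRingType) (V : lmodType R).

Definition sym_ker (F : lmodType R) (g : {linear V -> F}) : set (sym V) :=
  [set x | sym_map g x = 0].

(* F ranges over all free modules, of finite rank or not. *)
Definition rees_ideal : set (sym V) :=
  [set x | forall (F : lmodType R) (g : {linear V -> F}),
     free_module F -> sym_ker g x].

Definition rees_pred (x : sym V) : bool := `[< rees_ideal x >].

Fact rees_pred_zmod : zmod_closed rees_pred.
Proof.
split=> [|x y /asboolP Ix /asboolP Iy]; apply/asboolP => F g freeF.
  exact: rmorph0.
by rewrite /sym_ker /= rmorphB /= (Ix F g freeF) (Iy F g freeF) subr0.
Qed.

HB.instance Definition _ :=
  GRing.isZmodClosed.Build (sym V) rees_pred rees_pred_zmod.

Definition rees_closed : zmodClosed (sym V) :=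
  GRing.ZmodClosed.clone (sym V) rees_pred _.

Definition rees : Type := {ideal_quot rees_closed}.
HB.instance Definition _ := GRing.Zmodule.on rees.

Definition rees_pi (x : sym V) : rees := \pi_({ideal_quot rees_closed})%qT x.

Lemma rees_piP x y : rees_pi x = rees_pi y <-> rees_ideal (x - y).
Proof.
split=> [/eqP|Ixy].
  by rewrite /rees_pi -Quotient.idealrBE => /asboolP.
by apply/eqP; rewrite /rees_pi -Quotient.idealrBE; apply/asboolP.
Qed.

Lemma rees_ideal_mul a x : rees_ideal x -> rees_ideal (a * x).
Proof.
by move=> Ix F g freeF; rewrite /sym_ker /= rmorphM /= (Ix F g freeF) mulr0.
Qed.

Lemma rees_pi_zmod : zmod_morphism rees_pi.
Proof. by move=> x y; rewrite /rees_pi raddfB. Qed.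

HB.instance Definition _ :=
  GRing.isZmodMorphism.Build (sym V) rees rees_pi rees_pi_zmod.

Definition rees_repr (x : rees) : sym V := repr (x : {ideal_quot rees_closed}).

Lemma rees_reprK (x : rees) : rees_pi (rees_repr x) = x.
Proof. exact: reprK. Qed.

Lemma rees_repr_pi x : rees_ideal (rees_repr (rees_pi x) - x).
Proof. by apply/rees_piP; rewrite rees_reprK. Qed.

Lemma rees_ind_pi (P : rees -> Prop) : (forall x, P (rees_pi x)) -> forall x, P x.
Proof. by move=> H x; rewrite -[x]rees_reprK. Qed.

Definition rees_mul (x y : rees) : rees :=
  rees_pi (rees_repr x * rees_repr y).

Lemma rees_mulE x y : rees_mul (rees_pi x) (rees_pi y) = rees_pi (x * y).
Proof.
rewrite /rees_mul; set x' := rees_repr _; set y' := rees_repr _.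
apply/rees_piP; have -> : x' * y' - x * y = y' * (x' - x) + x * (y' - y).
  by rewrite !mulrBr [y' * x']mulrC [y' * x]mulrC addrA subrK.
move=> F g freeF; have Ix := rees_repr_pi x; have Iy := rees_repr_pi y.
rewrite /sym_ker /= rmorphD /=.
by rewrite (rees_ideal_mul y' Ix g freeF) (rees_ideal_mul x Iy g freeF) addr0.
Qed.

Fact rees_mulrA : associative rees_mul.
Proof.
elim/rees_ind_pi=> x; elim/rees_ind_pi=> y; elim/rees_ind_pi=> z.
by rewrite !rees_mulE mulrA.
Qed.

Fact rees_mulrC : commutative rees_mul.
Proof.
by elim/rees_ind_pi=> x; elim/rees_ind_pi=> y; rewrite !rees_mulE mulrC.
Qed.

Fact rees_mul1r : left_id (rees_pi 1) rees_mul.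
Proof. by elim/rees_ind_pi=> x; rewrite rees_mulE mul1r. Qed.

Fact rees_mulrDl : left_distributive rees_mul +%R.
Proof.
elim/rees_ind_pi=> x; elim/rees_ind_pi=> y; elim/rees_ind_pi=> z.
by rewrite -raddfD !rees_mulE mulrDl raddfD.
Qed.

HB.instance Definition _ := GRing.Zmodule_isComPzRing.Build rees
  rees_mulrA rees_mulrC rees_mul1r rees_mulrDl.

Lemma rees_pi_monoid : monoid_morphism rees_pi.
Proof. by split=> // x y; rewrite [RHS]rees_mulE. Qed.

HB.instance Definition _ :=
  GRing.isMonoidMorphism.Build (sym V) rees rees_pi rees_pi_monoid.

Definition rees_scale (a : R) (x : rees) : rees := rees_pi (sym_cst V a) * x.

Fact rees_scaleA a b x : rees_scale a (rees_scale b x) = rees_scale (a * b) x.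
Proof. by rewrite /rees_scale sym_cstrM rmorphM mulrA. Qed.

Fact rees_scale1 : left_id 1 rees_scale.
Proof. by move=> x; rewrite /rees_scale sym_cst1 rmorph1 mul1r. Qed.

Fact rees_scaleDr : right_distributive rees_scale +%R.
Proof. by move=> a x y; rewrite /rees_scale mulrDr. Qed.

Fact rees_scaleDl x : {morph rees_scale^~ x : a b / a + b}.
Proof. by move=> a b; rewrite /rees_scale sym_cstrD rmorphD mulrDl. Qed.

HB.instance Definition _ := GRing.Zmodule_isLmodule.Build R rees
  rees_scaleA rees_scale1 rees_scaleDr rees_scaleDl.

Lemma rees_pi_scalable : scalable rees_pi.
Proof. by move=> a x; rewrite sym_scaleE rmorphM. Qed.

HB.instance Definition _ :=
  GRing.isScalable.Build R (sym V) rees *:%R rees_pi rees_pi_scalable.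

Definition rees_deg (n : nat) : set rees := rees_pi @` sym_deg V n.

End ReesAlgebra.
Arguments rees_deg {R} V n.

Section ReesMap.
Variables (R : comPzRingType) (U V : lmodType R) (f : {linear U -> V}).

Definition rees_map (x : rees U) : rees V := rees_pi (sym_map f (rees_repr x)).

Lemma rees_mapE x : rees_map (rees_pi x) = rees_pi (sym_map f x).
Proof.
apply/rees_piP => F g freeF; rewrite /sym_ker /= -rmorphB /= -sym_map_comp.
exact: (rees_repr_pi x (g \o f) freeF).
Qed.

Lemma rees_map_zmod : zmod_morphism rees_map.
Proof.
elim/rees_ind_pi=> x; elim/rees_ind_pi=> y.
by rewrite -rmorphB !rees_mapE !rmorphB.
Qed.

Lemma rees_map_monoid : monoid_morphism rees_map.
Proof.
split=> [|x y]; first by rewrite -[1](rmorph1 (@rees_pi R U)) rees_mapE !rmorph1.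
elim/rees_ind_pi: x => x; elim/rees_ind_pi: y => y.
by rewrite -rmorphM !rees_mapE !rmorphM.
Qed.

Lemma rees_map_scalable : scalable rees_map.
Proof.
by move=> a; elim/rees_ind_pi=> x; rewrite -linearZ !rees_mapE !linearZ.
Qed.

HB.instance Definition _ :=
  GRing.isZmodMorphism.Build (rees U) (rees V) rees_map rees_map_zmod.
HB.instance Definition _ :=
  GRing.isMonoidMorphism.Build (rees U) (rees V) rees_map rees_map_monoid.
HB.instance Definition _ :=
  GRing.isScalable.Build R (rees U) (rees V) *:%R rees_map rees_map_scalable.

End ReesMap.

(* The inclusion of M in N is an injective linear map i. *)
Section Powers.
Variables (R : comPzRingType) (M N : lmodType R) (i : {linear M -> N}).

(* M^n : the image in R(N) of the n-th component of R(M). *)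
Definition rees_pow (n : nat) : set (rees N) := rees_map i @` rees_deg M n.

Definition integral_closure (n : nat) : set (rees N) :=
  [set g | rees_deg N n g /\
     exists (u : nat) (m : nat -> rees N),
       [/\ (0 < u)%N,
           forall j, (1 <= j <= u)%N -> rees_pow (n * j) (m j) &
           g ^+ u + \sum_(1 <= j < u.+1) m j * g ^+ (u - j) = 0]].

End Powers.
Arguments rees_pow {R M N} i n.
Arguments integral_closure {R M N} i n.

(* Main.v *)
(* Choose functionals generating the dual of N.  They identify the Rees       *)
(* algebra of N with a subalgebra of R[t_1..t_s] generated by linear forms    *)
(* (the images x_k of generators of N), so that M^n and N^n become the forms  *)
(* of degree n in the linear forms y_j, resp. x_k.  Modulo a minimal prime p  *)
(* of R everything lives in the domain K[t], K = Frac (R / p), and g lies in  *)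
(* the closure of M^n iff for each p its image is integral over the subring   *)
(* A = (R / p)[y_1..y_r] of K[t].  A prime P = (closure of M^n : c) is then   *)
(* the analogous colon for a single p.                                        *)
(*                                                                            *)
(* Inclusion.  If some y_j is nonzero modulo p, then g is integral over A as  *)
(* soon as all g y_j are (homogeneously), by a determinant trick, so P is     *)
(* (closure of M^(n+1) : c y_j) for some j.  Otherwise the closure is zero    *)
(* modulo p, P = p, and c is moved up by some x_k and by an element of the    *)
(* other minimal primes.                                                      *)
(*                                                                            *)
(* Stability.  It remains to see that finitely many P occur for each p.  If   *)
(* P contains an element outside p, then c is algebraic over A; projecting    *)
(* linear forms onto the span of the y_j gives a denominator d, depending     *)
(* only on p, with d^n c in A, whence d lies in P.  If no z in A had          *)
(* P = (dA : z), then some multiple a c with a outside P would stabilise the  *)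
(* ideal of A conducting A[P c] into A and be integral, a contradiction.  So  *)
(* P is the contraction of an associated prime of A / dA, with A Noetherian.  *)

Require Import Defs.
From HB Require Import structures.
From mathcomp Require Import all_boot all_algebra.
From mathcomp Require Import generic_quotient ring_quotient fraction.
From mathcomp Require Import boolp classical_sets.
From mathcomp Require Import mpoly ring zify.

Set Implicit Arguments.
Unset Strict Implicit.
Unset Printing Implicit Defensive.

Import GRing.Theory.
Local Open Scope ring_scope.
Local Open Scope classical_set_scope.

(** * Noetherian rings *)

(** Every map from [N] to a free module factors through finitely many generators of the dual of [N].
    Hence the Rees algebra of [N] embeds in a polynomial ring, and [rees_forms] replaces the powers
    of [M] and [N] by spaces of forms in linear forms [y j] and [x k]. Integral dependence ignores
    nilpotents, so it can be tested modulo finitely many primes with nilpotent intersection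
    ([form_closureP]). Modulo one prime the grading can be forgotten ([integral_modP]), and
    everything happens in a polynomial ring over a field. A prime that is a colon of the closure is
    already a colon modulo one of these primes ([closure_colon]).

    Persistence is [closure_ass_step]. If some [y j] survives modulo the relevant prime,
    multiplication by all the [y j] detects integrality ([integral_cancel]), so one of them carries
    [c] to the next degree. If none survives, the closure vanishes modulo that prime, and
    incomparability of the primes supplies the multiplier.

    For stability, the increasing sets need only lie in one finite set. By [common_denominator] and
    [ass_principal], a prime arising modulo [p] is either [p] or associated to one principal ideal
    that depends only on [p]; [fin_ass] and the Hilbert basis theorem then bound the possibilities
    ([fin_ass_mod]). *)

Section Ideals.
Variable R : comPzRingType.
Implicit Types I J P : set R.

Lemma ideal_sum I (T : Type) (s : seq T) (Q : pred T) (f : T -> R) :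
  is_ideal I -> (forall t, Q t -> I (f t)) -> I (\sum_(t <- s | Q t) f t).
Proof.
by move=> [I0 ID IM] If; elim/big_ind: _ => //; apply: ID.
Qed.

Lemma ideal_sub I a b : is_ideal I -> I a -> I b -> I (a - b).
Proof.
move=> [I0 ID IM] Ia Ib; apply: ID => //.
by rewrite -mulN1r; apply: IM.
Qed.

Lemma ideal_mulr I a b : is_ideal I -> I a -> I (a * b).
Proof. by move=> [I0 ID IM] Ia; rewrite mulrC; apply: IM. Qed.

Definition ideal_add I a : set R := [set x | exists2 y, I y & exists b, x = y + b * a].

Lemma ideal_add_ideal I a : is_ideal I -> is_ideal (ideal_add I a).
Proof.
move=> [I0 ID IM]; split=> [|x y|c x].
- by exists 0 => //; exists 0; rewrite mul0r addr0.
- move=> [u Iu [b ->]] [v Iv [c ->]]; exists (u + v); first exact: ID.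
  by exists (b + c); rewrite mulrDl addrACA.
- move=> [u Iu [b ->]]; exists (c * u); first exact: IM.
  by exists (c * b); rewrite mulrDr mulrA.
Qed.

Lemma ideal_add_sub I a : I `<=` ideal_add I a.
Proof. by move=> x Ix; exists x => //; exists 0; rewrite mul0r addr0. Qed.

Lemma ideal_add_gen I a : is_ideal I -> ideal_add I a a.
Proof. by move=> [I0 _ _]; exists 0 => //; exists 1; rewrite mul1r add0r. Qed.

Lemma prime_prod P (T : Type) (s : seq T) (f : T -> R) :
  is_prime_ideal P -> (forall t, ~ P (f t)) -> ~ P (\prod_(t <- s) f t).
Proof.
move=> [_ P1 PM] Pf; elim/big_rec: _ => // t x _ Px /PM[]; by [apply: Pf|].
Qed.

Lemma prime_exp P a n : is_prime_ideal P -> P (a ^+ n) -> P a.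
Proof.
move=> [_ P1 PM]; elim: n => [|n IH] //; rewrite exprS => /PM[] //.
Qed.

Lemma noetherian_ind (Q : set R -> Prop) : noetherian R ->
  (forall I, is_ideal I ->
     (forall J, is_ideal J -> I `<=` J -> ~ (J `<=` I) -> Q J) -> Q I) ->
  forall I, is_ideal I -> Q I.
Proof.
move=> noeR step I0 idI0; apply: contrapT => nQ0.
pose T := {I : set R | is_ideal I /\ ~ Q I}.
have next (I : T) : {J : T | sval I `<=` sval J /\ ~ (sval J `<=` sval I)}.
  apply: cid; case: I => I [idI nQ] /=; apply: contrapT => nex; apply: nQ.
  apply: step => // J idJ IJ nJI; apply: contrapT => nQJ; apply: nex.
  by exists (exist _ J (conj idJ nQJ)).
(* A strictly increasing chain of ideals at which [Q] fails; its union is finitely generated, so the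
   chain would have to stop. *)
pose F := fix F n : T := if n is n'.+1 then sval (next (F n')) else exist _ I0
  (conj idI0 nQ0).
have Fmono n k : sval (F n) `<=` sval (F (n + k)%N).
  elim: k => [|k IH]; rewrite ?addn0 // addnS => x /IH.
  exact: (proj1 (svalP (next (F (n + k)%N)))).
have Fle n m : (n <= m)%N -> sval (F n) `<=` sval (F m).
  by move=> /subnKC <-; apply: Fmono.
pose U : set R := [set x | exists n, sval (F n) x].
have idF n : is_ideal (sval (F n)) := proj1 (svalP (F n)).
have idU : is_ideal U.
  split=> [|x y [n Fx] [m Fy]|a x [n Fx]].
  - by exists 0%N; have [] := idF 0%N.
  - exists (n + m)%N; have [_ D _] := idF (n + m)%N; apply: D.
      exact: (Fle _ _ (leq_addr _ _)).
    exact: (Fle _ _ (leq_addl _ _)).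
  - by exists n; have [_ _ M] := idF n; apply: M.
have [n [a Ua]] := noeR U idU.
have aU i : U (a i).
  rewrite Ua; exists (fun j => (j == i)%:R);
    rewrite (bigD1 i) //= eqxx mul1r big1 ?addr0 //.
  by move=> j /negbTE ->; rewrite mul0r.
have [k ak] := choice aU.
pose K := (\sum_i k i)%N.
have UK : U `<=` sval (F K).
  move=> x; rewrite Ua => -[c ->]; apply: ideal_sum => // i _.
  have [_ _ M] := idF K; apply: M; apply: (Fle (k i)) => //.
  by rewrite /K (bigD1 i) //= leq_addr.
have [_] := svalP (next (F K)); apply => x Fx; apply: UK; exists K.+1; exact: Fx.
Qed.

Lemma fin_genP I : noetherian R -> is_ideal I ->
  exists (T : finType) (a : T -> R), (forall t, I (a t)) /\
    forall x, I x -> exists c : T -> R, x = \sum_t c t * a t.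
Proof.
move=> noeR idI; have [n [a Ia]] := noeR I idI.
exists 'I_n, a; split=> [i|x]; last by rewrite Ia.
rewrite Ia; exists (fun j => (j == i)%:R);
  rewrite (bigD1 i) //= eqxx mul1r big1 ?addr0 //.
by move=> j /negbTE ->; rewrite mul0r.
Qed.

Lemma noetherianI :
  (forall I, is_ideal I ->
  exists (T : finType) (a : T -> R), (forall t, I (a t)) /\
    forall x, I x -> exists c : T -> R, x = \sum_t c t * a t) -> noetherian R.
Proof.
move=> H I idI; have [T [a [Ia Igen]]] := H I idI.
exists #|T|, (fun i => a (enum_val i)); apply/seteqP; split=> [x /Igen[c ->]|x [c ->]].
  by exists (fun i => c (enum_val i)); rewrite
    (reindex (fun i : 'I_#|T| => enum_val i)) //=; exact: onW_bij (enum_val_bij T).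
by apply: ideal_sum => // i _; have [_ _ M] := idI; apply: M.
Qed.

(* R^q is modelled as the sequences that vanish from q on. *)
Lemma noetherian_submod (q : nat) (S : set (nat -> R)) : noetherian R ->
  (forall u v, S u -> S v -> S (fun j => u j + v j)) ->
  S (fun=> 0) ->
  (forall a v, S v -> S (fun j => a * v j)) ->
  (forall v, S v -> forall j, (q <= j)%N -> v j = 0) ->
  exists (T : finType) (b : T -> nat -> R), (forall t, S (b t)) /\
    forall v, S v -> exists c : T -> R, forall j, v j = \sum_t c t * b t j.
Proof.
move=> noeR; elim: q S => [|q IH] S SD S0 SM Ssup.
  exists 'I_0, (fun _ _ => 0); split=> [[]//|v Sv].
  by exists (fun=> 0) => j; rewrite big_ord0 Ssup.
pose I : set R := [set x | exists2 v, S v & v q = x].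
have idI : is_ideal I.
  split=> [|x y [u Su <-] [v Sv <-]|a x [u Su <-]].
  - by exists (fun=> 0).
  - by exists (fun j => u j + v j) => //; apply: SD.
  - by exists (fun j => a * u j) => //; apply: SM.
have [T1 [a [Ia Igen]]] := fin_genP noeR idI.
have [t|b1 b1S] := @choice _ _ (fun t v => S v /\ v q = a t).
  by have [v] := Ia t; exists v.
pose S' : set (nat -> R) := [set v | S v /\ forall j, (q <= j)%N -> v j = 0].
have [T2 [b2 [b2S S'gen]]] : exists (T : finType) (b : T -> nat -> R),
  (forall t, S' (b t)) /\
    forall v, S' v -> exists c : T -> R, forall j, v j = \sum_t c t * b t j.
  apply: IH => [u v [Su zu] [Sv zv]||c v [Sv zv]|v [_ zv]] //; split => //.
  - exact: SD.
  - by move=> j qj; rewrite zu ?zv ?addr0.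
  - exact: SM.
  - by move=> j qj; rewrite zv ?mulr0.
exists (T1 + T2)%type, (fun t => match t with inl t => b1 t | inr t => b2 t end).
split=> [[t|t]|v Sv]; [by case: (b1S t)|by case: (b2S t)|].
have [|c1 c1E] := Igen (v q); first by exists v.
have Ssum (T : Type) (s : seq T) (f : T -> nat -> R) :
    (forall t, S (f t)) -> S (fun j => \sum_(t <- s) f t j).
  move=> Sf; elim: s => [|t s IHs].
    by rewrite (_ : (fun _ => _) = fun=> 0) //; apply/funext=> j; rewrite big_nil.
  rewrite (_ : (fun _ => _) = fun j => f t j + \sum_(t <- s) f t j); first exact: SD.
  by apply/funext=> j; rewrite big_cons.
pose w j := \sum_t c1 t * b1 t j.
have Sw : S w by apply: Ssum => t; apply: SM; case: (b1S t).
have [|c2 c2E] := S'gen (fun j => v j + (-1) * w j).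
  split=> [|j qj]; first by apply: SD => //; apply: SM.
  rewrite leq_eqVlt in qj; case/orP: qj => [/eqP <-|qj];
    last by rewrite !Ssup ?mulr0 ?addr0.
  rewrite c1E /w mulN1r; apply/eqP; rewrite subr_eq0; apply/eqP.
  by apply: eq_bigr => t _; case: (b1S t) => _ ->.
exists (fun t => match t with inl t => c1 t | inr t => c2 t end) => j.
by rewrite big_sumType /= -c2E mulN1r /w addrC subrK.
Qed.

(** Noetherian induction: if [a * b] lies in [I] but neither factor does, the lists of primes for
    [I + (a)] and [I + (b)] concatenate, because the product of these two ideals lies in [I]. *)
Lemma noetherian_prod_primes I : noetherian R -> is_ideal I ->
  exists n (p : 'I_n -> set R), (forall i, is_prime_ideal (p i)) /\
    forall a : 'I_n -> R, (forall i, p i (a i)) -> I (\prod_i a i).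
Proof.
move=> noeR idI; move: I idI; apply: (noetherian_ind noeR) => I idI IH.
have [I1|nI1] := pselect (I 1).
  by exists 0%N, (fun=> I); split=> [[]//|a _]; rewrite big_ord0.
have [prI|nprI] := pselect (is_prime_ideal I).
  by exists 1%N, (fun=> I); split=> // a Ia; rewrite big_ord1.
have [a [b [Iab nIa nIb]]] : exists a b, [/\ I (a * b), ~ I a & ~ I b].
  apply: contrapT => H; apply: nprI; split=> // a b Iab;
    apply: contrapT => /not_orP[nIa nIb].
  by apply: H; exists a, b.
have [|||n [p [prp pP]]] := IH (ideal_add I a);
  [exact: ideal_add_ideal|exact: ideal_add_sub| |].
  by apply: contra_not nIa; apply; apply: ideal_add_gen.
have [|||m [q [prq qP]]] := IH (ideal_add I b);
  [exact: ideal_add_ideal|exact: ideal_add_sub| |].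
  by apply: contra_not nIb; apply; apply: ideal_add_gen.
exists (n + m)%N, (fun i => match split i with inl i => p i | inr i => q i end).
split=> [i|c cP]; first by case: (split i).
rewrite big_split_ord /=.
have [|u Iu [u' ->]] := pP (fun i => c (lshift m i)).
  by move=> i; have := cP (lshift m i); rewrite (unsplitK (inl i)).
have [|v Iv [v' ->]] := qP (fun i => c (rshift n i)).
  by move=> i; have := cP (rshift n i); rewrite (unsplitK (inr i)).
have [_ ID IM] := idI.
rewrite mulrDl; apply: (ID); first exact: ideal_mulr.
rewrite mulrDr; apply: ID; first exact: IM.
by rewrite mulrACA; apply: IM.
Qed.

Lemma spec_eq (p q : spec R) : (p : set R) = q -> p = q.
Proof.
by case: p q => [p prp] [q prq] /= pq; subst q; rewrite (Prop_irrelevance prp prq).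
Qed.

End Ideals.

(** * Finiteness of contracted associated primes *)

Section FiniteAss.
Variables (R A : comPzRingType) (f : {rmorphism R -> A}).

(** Noetherian induction on [I]. Some colon [(I : w)] is prime; a prime [P] annihilating a class [z]
    either survives modulo [I + (w)], or some multiple of [z] by an element outside [P] falls into
    that ideal, and then [P] is the contraction of [(I : w)]. *)
Lemma fin_ass (I : set A) : noetherian A -> is_ideal I ->
  exists n (L : 'I_n -> set R), forall P, is_prime_ideal P ->
    (exists z, P = [set a | I (f a * z)]) -> exists i, P = L i.
Proof.
move=> noeA idI; move: I idI; apply: (noetherian_ind noeA) => I idI IH.
have [I1|nI1] := pselect (I 1).
  exists 0%N, (fun=> set0) => P [_ P1 _] [z PE]; exfalso; apply: P1; rewrite PE /=.
  by have [_ _ IM] := idI; rewrite -[_ * _]mulr1; apply: IM.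
have [w [nIw wP]] : exists w, ~ I w /\ is_prime_ideal [set x | I (x * w)].
  pose Q J := (exists2 w, ~ I w & J = [set x | I (x * w)]) ->
    exists w, ~ I w /\ is_prime_ideal [set x | I (x * w)].
  have [I0 ID IM] := idI.
  have idw w : is_ideal [set x | I (x * w)].
    split=> [|x y Ix Iy|a x Ix] /=; first by rewrite mul0r.
      by rewrite mulrDl; apply: ID.
    by rewrite -mulrA; apply: IM.
  suff: Q [set x | I (x * 1)] by apply; exists 1.
  apply: (noetherian_ind noeA) => // J idJ IHJ [w nIw JE].
  have [prJ|nprJ] := pselect (is_prime_ideal J); first by exists w; rewrite -JE.
  have [a [b [Jab nJa nJb]]] : exists a b, [/\ J (a * b), ~ J a & ~ J b].
    apply: contrapT => H; apply: nprJ; split=> //; first by rewrite JE /= mul1r.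
    move=> a b Jab; apply: contrapT => /not_orP[nJa nJb].
    by apply: H; exists a, b.
  apply: (IHJ [set x | I (x * (a * w))]) => //.
  - move=> x; rewrite JE /= => Ix; by rewrite mulrCA; apply: IM.
  - move=> /(_ b); apply: contra_not => H; exfalso; apply: nJb; apply: H => /=.
    by move: Jab; rewrite JE /= mulrCA mulrA.
  - by exists (a * w) => //; move: nJa; rewrite JE.
have [|||n [L LP]] := IH (ideal_add I w);
  [exact: ideal_add_ideal|exact: ideal_add_sub| |].
  by apply: contra_not nIw; apply; apply: ideal_add_gen.
exists n.+1, (fun i => if unlift ord0 i is Some j then L j else [set a | I (f a * w)]).
move=> P prP [z PE].
have [[a nPa Jaz]|H] := pselect (exists2 a, ~ P a & ideal_add I w (f a * z));
  last first.
  have [|i ->] := LP P prP; last by exists (lift ord0 i); rewrite liftK.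
  exists z; apply/seteqP; split=> [x|x Jx]; first by rewrite {1}PE => Ix;
    apply: ideal_add_sub.
  by apply: contrapT => nPx; apply: H; exists x.
exists ord0; rewrite unlift_none.
case: Jaz => i Ii [b abE]; have [_ P1 PM] := prP; have [_ ID IM] := idI.
have PE' : P = [set x | I (f x * b * w)].
  have E x : P x <-> I (f x * b * w).
    have -> : f x * b * w = f (x * a) * z - f x * i.
      by rewrite rmorphM -mulrA -(mulrA _ _ z) abE mulrDr addrC addKr.
    split=> [Px|H].
      apply: ideal_sub => //; last exact: IM.
      have : P (x * a) by have [[_ _ M] _ _] := prP; rewrite mulrC; apply: M.
      by rewrite {1}PE.
    have : P (x * a); last by case/PM.
    by rewrite PE /= -[_ * z](subrK (f x * i)); apply: ID => //; apply: IM.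
  by apply/seteqP; split=> x /E.
(* Primality of [(I : w)] removes the factor [b]: if [b * w] were in [I], then [P] would contain
   1. *)
have [_ _ wM] := wP; rewrite PE'; apply/seteqP; split=> x /=; last first.
  by rewrite mulrAC => Ix; apply: ideal_mulr.
case/wM => // bI; exfalso; apply: P1; rewrite PE' /= rmorph1 mul1r; exact: bI.
Qed.

End FiniteAss.

(** * The Hilbert basis theorem *)

Section Hilbert.

Lemma noetherian_surj (A B : comPzRingType) (f : {rmorphism A -> B}) :
  (forall b, exists a, f a = b) -> noetherian A -> noetherian B.
Proof.
move=> fsurj noeA; apply: noetherianI => I idI; have [I0 ID IM] := idI.
have [|T [a [Ia Igen]]] := @fin_genP _ (f @^-1` I) noeA.
  split=> [|x y|c x] /=; rewrite ?rmorph0 ?rmorphD ?rmorphM //; [exact: ID|exact: IM].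
exists T, (f \o a); split=> // x Ix; have [y yE] := fsurj x.
have [|c cE] := Igen y; first by rewrite /= yE.
by exists (f \o c); rewrite -yE cE rmorph_sum; apply: eq_bigr => t _; rewrite rmorphM.
Qed.

Theorem hilbert_basis (R : comNzRingType) : noetherian R -> noetherian {poly R}.
Proof.
move=> noeR; apply: noetherianI => J idJ; have [J0 JD JM] := idJ.
pose L : set R := [set a | exists n, exists2 p : {poly R}, J p & (size p <= n.+1)%N /\
  p`_n = a].
have shift n k (p : {poly R}) : J p -> (size p <= n.+1)%N -> 
    exists2 q, J q & (size q <= (n + k).+1)%N /\ q`_(n + k) = p`_n.
  move=> Jp sp; exists ('X^k * p); first exact: JM.
  rewrite coefXnM ltnNge leq_addl /= addnK; split => //.
  apply: leq_trans (size_mul_leq _ _) _.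
  by rewrite size_polyXn /= addnC -addSn leq_add2r.
have idL : is_ideal L.
  split=> [|a b|c a].
  - by exists 0%N, 0 => //; rewrite size_poly0 coef0.
  - move=> [n [p Jp [sp <-]]] [m [q Jq [sq <-]]]; exists (n + m)%N.
    have [p' Jp' [sp' <-]] := shift n m p Jp sp.
    have := shift m n q Jq sq; rewrite (addnC m n) => -[q' Jq' [sq' <-]].
    exists (p' + q'); first exact: JD.
    by rewrite coefD; split=> //; rewrite
      (leq_trans (size_polyD _ _)) // geq_max sp' sq'.
  - move=> [n [p Jp [sp <-]]]; exists n, (c *: p); first by rewrite -mul_polyC;
    apply: JM.
    by rewrite coefZ; split=> //; rewrite (leq_trans (size_scale_leq _ _)).
have [T1 [a [La Lgen]]] := fin_genP noeR idL.
have [n0 n0P] := choice La.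
(* Multiplying by powers of ['X] brings lifts of all generators of the leading ideal [L] to the
   common degree [d]. What lies in [J] below degree [d] is a submodule of a finite free module. *)
pose d := (\sum_t n0 t)%N.
have [t|p pP] := @choice _ _ (fun t (p : {poly R}) =>
  [/\ J p, (size p <= d.+1)%N & p`_d = a t]).
  have [q Jq [sq qE]] := n0P t.
  have [p Jp [sp pE]] := shift (n0 t) (d - n0 t)%N q Jq sq.
  move: sp pE; rewrite subnKC => [sp pE|]; last by rewrite /d (bigD1 t) //= leq_addr.
  by exists p; split => //; rewrite pE qE.
pose S : set (nat -> R) := [set v | exists2 p : {poly R}, J p & (size p <= d)%N /\
  forall j, v j = p`_j].
have [|||v [q Jq [sq qE]] j dj|T2 [b [bS Sgen]]] := @noetherian_submod _ d S noeR.
- move=> u v [q Jq [sq qE]] [r Jr [sr rE]]; exists (q + r); first exact: JD.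
  split=> [|j]; last by rewrite coefD qE rE.
  by rewrite (leq_trans (size_polyD _ _)) // geq_max sq sr.
- by exists 0 => //; split=> [|j]; rewrite ?size_poly0 ?coef0.
- move=> c v [q Jq [sq qE]]; exists (c *: q); first by rewrite -mul_polyC; apply: JM.
  by split=> [|j]; rewrite ?coefZ ?qE // (leq_trans (size_scale_leq _ _)).
- by rewrite qE nth_default // (leq_trans sq).
have [t|r rP] := @choice _ _ (fun t (r : {poly R}) => J r /\ forall j, b t j = r`_j).
  by have [r Jr [_ rE]] := bS t; exists r.
exists (T1 + T2)%type, (fun t => match t with inl t => p t | inr t => r t end).
split=> [[t|t]|g]; [by case: (pP t)|by case: (rP t)|].
have [n] := ubnP (size g); elim: n g => // n IH g gn Jg.
have [gd|dg] := leqP (size g) d.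
  have [|c cE] := Sgen (fun j => g`_j); first by exists g.
  exists (fun t => match t with inl t => 0 | inr t => (c t)%:P end).
  rewrite big_sumType /= big1 ?add0r => [|t _]; last by rewrite mul0r.
  apply/polyP => j; rewrite cE coef_sum; apply: eq_bigr => t _.
  by rewrite coefCM; case: (rP t) => _ ->.
have [|c cE] := Lgen (lead_coef g).
  by exists (size g).-1, g => //; rewrite prednK ?leqnn //; apply: leq_ltn_trans dg.
pose k := ((size g).-1 - d)%N.
(* [h] lies in [J] and has the leading term of [g], so [g - h] is shorter. *)
pose h : {poly R} := \sum_t ((c t)%:P * 'X^k) * p t.
have kd : (k + d = (size g).-1)%N by rewrite subnK // -ltnS prednK // (leq_trans _ dg).
have g0 : (0 < size g)%N by apply: leq_trans dg.
have sh : (size h <= size g)%N.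
  apply: leq_trans (size_sum _ _ _) _; apply/bigmax_leqP => t _.
  rewrite -mulrA; apply: leq_trans (size_mul_leq _ _) _; rewrite size_polyC.
  have [_ sp _] := pP t.
  have sXp : (size (('X^k : {poly R}) * p t)%R <= size g)%N.
    apply: leq_trans (size_mul_leq _ _) _; rewrite size_polyXn /=.
    by rewrite -(prednK g0) -kd -addnS leq_add2l.
  by case: (_ != 0); rewrite //= add0n (leq_trans (leq_pred _)).
have hE : h`_(size g).-1 = lead_coef g.
  rewrite cE coef_sum; apply: eq_bigr => t _.
  rewrite -mulrA coefCM coefXnM ltnNge -kd leq_addr /= addKn.
  by case: (pP t) => _ _ ->.
have Jh : J h.
  by apply: ideal_sum => // t _; apply: JM; case: (pP t).
have [||e eE] := IH (g - h).
- rewrite -ltnS (leq_trans _ gn) // ltnS -(prednK g0) ltnS; apply/leq_sizeP => j.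
  rewrite coefB leq_eqVlt => /orP[/eqP <-|gj]; first by rewrite hE subrr.
  by rewrite !nth_default ?subrr // ?(leq_trans sh) // -(prednK g0).
- exact: ideal_sub.
exists (fun t => match t with inl t => e (inl t) + (c t)%:P * 'X^k | inr t =>
  e (inr t) end).
move: eE; rewrite !big_sumType /= => /eqP; rewrite subr_eq => /eqP ->.
rewrite addrAC /h; congr (_ + _); rewrite -big_split /=; apply: eq_bigr => t _.
by rewrite mulrDl.
Qed.

Lemma mpoly_ring_ind (R : nzRingType) n (P : {mpoly R[n]} -> Prop) :
  (forall c, P c%:MP) -> (forall i, P 'X_i) ->
  (forall p q, P p -> P q -> P (p + q)) ->
  (forall p q, P p -> P q -> P (p * q)) -> forall p, P p.
Proof.
move=> PC PX PD PM p; rewrite (mpolyE p).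
have P0 : P 0 by rewrite -mpolyC0; apply: PC.
have P1 : P 1 by rewrite -mpolyC1; apply: PC.
elim/big_ind: _ => // m _; rewrite -mul_mpolyC; apply: (PM) => //.
rewrite mpolyXE_id; elim/big_ind: _ => // i _.
by elim: (m i) => [|k IH]; rewrite ?expr0 // exprS; apply: PM.
Qed.

Lemma mpoly_rmorph_ext (R : nzRingType) (S : nzRingType) n
  (f g : {rmorphism {mpoly R[n]} -> S}) :
  (forall c, f c%:MP = g c%:MP) -> (forall i, f 'X_i = g 'X_i) -> f =1 g.
Proof.
move=> eC eX; apply: mpoly_ring_ind => // p q ep eq.
  by rewrite !rmorphD ep eq.
by rewrite !rmorphM ep eq.
Qed.

Lemma mpoly_noetherian (R : comNzRingType) n : noetherian R -> noetherian {mpoly R[n]}.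
Proof.
move=> noeR; elim: n => [|n IH].
  apply: (@noetherian_surj _ _ (@mpolyC 0 R)) noeR => b.
  exists b@_0%MM; apply/mpolyP => m; rewrite mcoeffC.
  by rewrite (_ : m = 0%MM) ?eqxx ?mulr1 //; apply/mnmP => -[].
pose f : {rmorphism {poly {mpoly R[n]}} -> {mpoly R[n.+1]}} :=
  horner_eval 'X_ord_max \o map_poly (@mwiden n R).
apply: (@noetherian_surj _ _ f); last exact: hilbert_basis.
apply: mpoly_ring_ind => [c|i|p q [p' <-] [q' <-]|p q [p' <-] [q' <-]].
- by exists (c%:MP)%:P; rewrite /f /= map_polyC /horner_eval hornerC /= mwidenC.
- have [i' ->|->] := unliftP ord_max i; last first.
    by exists 'X; rewrite /f /= map_polyX /horner_eval hornerX.
  exists ('X_i')%:P; rewrite /f /= map_polyC /horner_eval hornerC /= mwidenX mnmwiden1.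
  by congr 'X_[U_(_)]; apply: val_inj; rewrite /= /bump leqNgt ltn_ord.
- by exists (p' + q'); rewrite rmorphD.
- by exists (p' * q'); rewrite rmorphM.
Qed.

End Hilbert.

(** * Integral elements in a domain *)

Section DetTrick.
Variables (G : comNzRingType) (C : idomainType) (psi : {rmorphism G -> C}).

(* Determinant trick: the characteristic polynomial of [a] annihilates [z]. *)
Lemma integral_stable (T : finType) (w : T -> C) (z : C) (a : T -> T -> G) :
  (forall t, z * w t = \sum_u psi (a t u) * w u) -> (exists t, w t != 0) ->
  integralOver psi z.
Proof.
move=> wE [t0 wt0].
pose A : 'M[G]_#|T| := \matrix_(i, j) a (enum_val i) (enum_val j).
pose B := map_mx psi A.
pose v : 'cV[C]_#|T| := \col_i w (enum_val i).
exists (char_poly A); first exact: char_poly_monic.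
rewrite map_char_poly -/B /root; apply/eqP.
have Bv : (z%:M - B) *m v = 0.
  apply/matrixP => i j; rewrite mulmxBl mul_scalar_mx !mxE wE.
  apply/eqP; rewrite subr_eq0; apply/eqP.
  rewrite (reindex (fun i : 'I_#|T| => enum_val i)) /=;
    last exact: onW_bij (enum_val_bij T).
  by apply: eq_bigr => k _; rewrite !mxE.
have det0 : \det (z%:M - B) *: v = 0.
  by rewrite -mul_scalar_mx -mul_adj_mx -mulmxA Bv mulmx0.
have : \det (z%:M - B) = 0.
  have /matrixP/(_ (enum_rank t0) ord0) := det0; rewrite !mxE enum_rankK => /eqP.
  by rewrite mulf_eq0 (negbTE wt0) orbF => /eqP.
move=> <-; rewrite /char_poly -horner_evalE -det_map_mx; congr (\det _).
apply/matrixP => i j; rewrite !mxE rmorphB rmorphMn /= !horner_evalE.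
by rewrite hornerX hornerC.
Qed.

End DetTrick.

Lemma fraction_ratio (D : idomainType) (z : {fraction D}) :
  exists x y : D, y != 0 /\ z = tofrac x / tofrac y.
Proof.
elim/quotW: z => x; exists \n_x, \d_x; rewrite denom_ratioP; split=> //.
have d0 : tofrac \d_x != 0 by rewrite tofrac_eq0 denom_ratioP.
apply: (mulIf d0); rewrite divfK //; apply/eqP.
rewrite -[_ * _]/(FracField.mul _ _) !piE FracField.equivfE /FracField.mulf.
by rewrite !numden_Ratio ?mulf_neq0 ?oner_eq0 ?denom_ratioP // !mulr1 mulrC.
Qed.

(** * Residue fields of primes *)

Section ResidueField.
Variables (R : comNzRingType) (P : set R) (prP : is_prime_ideal P).

Definition prime_pred : pred R := fun x => `[< P x >].

Fact prime_pred_zmod : zmod_closed prime_pred.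
Proof.
have [idP _ _] := prP; split=> [|x y /asboolP Px /asboolP Py]; apply/asboolP.
  by case: idP.
exact: ideal_sub.
Qed.

Fact prime_pred_proper :
  1 \notin prime_pred /\ forall a, {in prime_pred, forall u, a * u \in prime_pred}.
Proof.
have [[_ _ PM] P1 _] := prP; split=> [|a x /asboolP Px]; first by apply/asboolP.
by apply/asboolP; apply: PM.
Qed.

Fact prime_pred_prime : @prime_idealr_closed R prime_pred.
Proof.
have [_ _ PM] := prP => x y /asboolP/PM[] H; apply/orP; [left|right]; exact/asboolP.
Qed.

HB.instance Definition _ := GRing.isZmodClosed.Build R prime_pred prime_pred_zmod.
HB.instance Definition _ := isProperIdeal.Build R prime_pred prime_pred_proper.
HB.instance Definition _ := isPrimeIdealrClosed.Build R prime_pred prime_pred_prime.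

Definition prime_ideal_pack : prime_idealr R := PrimeIdealr.clone R prime_pred _.
Definition prime_quot : Type := {ideal_quot prime_ideal_pack}.
HB.instance Definition _ := GRing.ComNzRing.on prime_quot.

Definition pq_unit : {pred prime_quot} := fun x => `[< exists y, y * x = 1 >].
Definition pq_inv (x : prime_quot) : prime_quot :=
  if pselect (exists y, y * x = 1) is left ex then sval (cid ex) else x.

Fact pq_mulVx : {in pq_unit, left_inverse 1 pq_inv *%R}.
Proof.
move=> x /asboolP ux; rewrite /pq_inv; case: pselect => // ex; exact: svalP (cid ex).
Qed.

Fact pq_unitPl (x y : prime_quot) : y * x = 1 -> pq_unit x.
Proof. by move=> yx; apply/asboolP; exists y. Qed.

Fact pq_invr_out : {in [predC pq_unit], pq_inv =1 id}.
Proof.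
by move=> x /asboolP ux; rewrite /pq_inv; case: pselect => // ex; case: ux.
Qed.

HB.instance Definition _ :=
  GRing.ComNzRing_hasMulInverse.Build prime_quot pq_mulVx pq_unitPl pq_invr_out.
HB.instance Definition _ := GRing.ComUnitRing_isIntegral.Build prime_quot
  (@Quotient.rquot_IdomainAxiom R prime_ideal_pack).

Lemma residue_field : exists (K : fieldType) (phi : {rmorphism R -> K}),
  (forall a, phi a = 0 <-> P a) /\
  (forall z, exists a b, phi b != 0 /\ z = phi a / phi b).
Proof.
pose pi : {rmorphism R -> prime_quot} := \pi_({ideal_quot prime_ideal_pack})%qT.
exists {fraction prime_quot}, (@tofrac prime_quot \o pi : {rmorphism _ -> _}).
have ker a : tofrac (pi a) = 0 <-> P a.
  split=> [/eqP|Pa].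
    rewrite tofrac_eq0 => /eqP pa0; apply/asboolP.
    have : pi a == pi 0 by rewrite pa0 rmorph0.
    by rewrite /pi /= -Quotient.idealrBE subr0.
  apply/eqP; rewrite tofrac_eq0; apply/eqP.
  have /eqP : pi a == pi 0; last by rewrite rmorph0.
  by rewrite /pi /= -Quotient.idealrBE subr0; apply/asboolP.
split=> // z; have [x [y [y0 ->]]] := fraction_ratio z.
exists (repr (x : {ideal_quot prime_ideal_pack})),
  (repr (y : {ideal_quot prime_ideal_pack})).
have piK u : pi (repr (u : {ideal_quot prime_ideal_pack})) = u by apply: reprK.
by rewrite /= !piK tofrac_eq0.
Qed.
End ResidueField.

Lemma horner_map_monic (A B : comNzRingType) (f : {rmorphism A -> B})
  (q : {poly A}) u z :
  q \is monic -> size q = u.+1 ->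
  (map_poly f q).[z] = \sum_(k < u) f q`_k * z ^+ k + z ^+ u.
Proof.
move=> mq sq; have qu : q`_u = 1 by rewrite -(monicP mq) lead_coefE sq.
rewrite horner_coef size_map_poly_id0 ?lead_coefE sq /= ?qu ?rmorph1 ?oner_neq0 //.
have fq : (map_poly f q)`_u = 1 by rewrite coef_map /= qu rmorph1.
rewrite big_ord_recr /= fq mul1r; congr (_ + _).
by apply: eq_bigr => k _; rewrite coef_map.
Qed.

(** * Conductors and associated primes of principal ideals *)

Section DomainLemmas.
Variables (G : comNzRingType) (C : idomainType) (psi : {rmorphism G -> C}).

Lemma integral_pow b : integralOver psi b ->
  exists u (a : nat -> G), b ^+ u = \sum_(j < u) psi (a j) * b ^+ j.
Proof.
case=> p mp /rootP; have sp : size p = (size p).-1.+1 by rewrite prednK //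
  size_poly_gt0 monic_neq0.
rewrite (horner_map_monic _ _ mp sp) => /eqP; rewrite addrC addr_eq0 => /eqP bE.
exists (size p).-1, (fun j => - p`_j); rewrite bE -sumrN; apply: eq_bigr => j _.
by rewrite rmorphN mulNr.
Qed.

(** The algebra generated by [bs] is represented by its monomials: conducting it into the image of
    [psi] is tested on these. *)
Fixpoint monomial_in (bs : seq C) (z : C) : Prop :=
  if bs is b :: bs' then exists k z', monomial_in bs' z' /\ z = b ^+ k * z' else z = 1.

Lemma monomial_in1 bs : monomial_in bs 1.
Proof. by elim: bs => //= b bs IH; exists 0%N, 1; rewrite mulr1. Qed.

Lemma monomial_in_mul bs b z : b \in bs -> monomial_in bs z -> monomial_in bs (b * z).
Proof.
elim: bs z => //= b' bs IH z; rewrite inE => bb [k [z' [mz' ->]]].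
have [-> | nb] := eqVneq b b'; first by exists k.+1, z'; rewrite exprS mulrA.
rewrite (negbTE nb) /= in bb.
by exists k, (b * z'); split; [apply: IH|rewrite mulrCA].
Qed.

Lemma monomial_inM bs z z' : monomial_in bs z -> monomial_in bs z' ->
  monomial_in bs (z * z').
Proof.
elim: bs z z' => [z z' -> ->|b bs IH _ _ [k [z [mz ->]]] [k' [z' [mz' ->]]]] /=.
  by rewrite mulr1.
by exists (k + k')%N, (z * z'); split; [apply: IH|rewrite exprD; ring].
Qed.

(** If [b] satisfies an equation of degree [u], powers [b ^+ k] with [k >= u] reduce to lower ones,
    and [delta ^+ u] clears the rest. One exponent therefore serves all monomials. *)
Lemma monomial_in_conductor (delta : G) (bs : seq C) :
  (forall b, b \in bs -> integralOver psi b /\ exists g, psi delta * b = psi g) ->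
  exists K, forall z, monomial_in bs z -> exists g, psi delta ^+ K * z = psi g.
Proof.
elim: bs => [|b bs IH] H.
  by exists 0%N => z ->; exists 1; rewrite expr0 mulr1 rmorph1.
have [|K HK] := IH; first by move=> b' bb'; apply: H; rewrite inE bb' orbT.
have [ib [g0 g0E]] : integralOver psi b /\ exists g, psi delta * b = psi g.
  by apply: H; rewrite inE eqxx.
have [u [a aE]] := integral_pow ib.
exists (K + u)%N => _ [k [z [mz ->]]].
have [g gE] := HK z mz.
elim/ltn_ind: k => k IHk; have [uk|ku] := leqP u k.
  have [h hE] : exists h : nat -> G, forall j : 'I_u,
      psi delta ^+ (K + u) * (b ^+ (j + (k - u)) * z) = psi (h j).
    have [j|h hE] := @choice nat G (fun j h => (j < u)%N -> 
      psi delta ^+ (K + u) * (b ^+ (j + (k - u)) * z) = psi h); last first.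
      by exists h => j; apply: hE.
    have [ju|uj] := ltnP j u; last by exists 0.
    have [|h hE] := IHk (j + (k - u))%N; last by exists h.
    by lia.
  exists (\sum_(j < u) a j * h j); rewrite -(subnKC uk)
    (exprD b) aE rmorph_sum !mulr_suml mulr_sumr.
  by apply: eq_bigr => j _; rewrite rmorphM -hE !exprD; ring.
exists (delta ^+ (u - k) * g0 ^+ k * g).
rewrite !rmorphM !rmorphXn -g0E -gE exprD exprMn -{1}(subnKC (ltnW ku)) exprD.
ring.
Qed.

End DomainLemmas.

Section AssPrincipal.
Variables (R G : comNzRingType) (C : idomainType).
Variables (f : {rmorphism R -> G}) (psi : {rmorphism G -> C}).
Hypotheses (noeR : noetherian R) (noeG : noetherian G).

(** This is the principal ideal of [psi d] in the image ring, pulled back to [G], so that Noetherian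
    arguments run in [G] itself. *)
Lemma principal_ideal (d : G) : is_ideal [set z : G | exists g, psi z = psi d * psi g].
Proof.
split=> [|x y [g gE] [h hE]|a x [g gE]] /=.
- by exists 0; rewrite !rmorph0 mulr0.
- by exists (g + h); rewrite !rmorphD mulrDr gE hE.
- by exists (a * g); rewrite !rmorphM gE mulrCA.
Qed.

(* The ideal [omega] of the elements of [G] conducting the finite algebra      *)
(* generated by [P c] into [G] is stable under [P c].  If no element           *)
(* [d c w] with [w] in [omega] had annihilator [P] modulo [d], then [a c]      *)
(* would stabilise [omega] for some [a] outside [P], making [a c] integral.    *)
Lemma ass_principal (d : R) (c : C) (N : nat) (m : G) (P : set R) :
  is_prime_ideal P -> P = [set a | integralOver psi (psi (f a) * c)] ->
  P d -> psi (f d) != 0 -> psi (f d) ^+ N * c = psi m ->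
  exists z, P = [set a | exists g, psi (f a * z) = psi (f d) * psi g].
Proof.
move=> prP PE Pd d0 mE; have [idP P1 PM] := prP.
have [T [a [Pa Pgen]]] := fin_genP noeR idP.
pose bs := [seq psi (f (a t)) * c | t <- enum T].
have [b|K HK] := @monomial_in_conductor G C psi (f d ^+ N) bs.
  move=> /mapP[t _ ->]; split; first by have := Pa t; rewrite {1}PE.
  by exists (f (a t) * m); rewrite rmorphXn mulrCA mE rmorphM.
pose om : set G := [set w | forall z, monomial_in bs z -> exists g, psi w * z = psi g].
have idom : is_ideal om.
  split=> [z _|x y ox oy z mz|b x ox z mz].
  - by exists 0; rewrite rmorph0 mul0r.
  - have [g gE] := ox z mz; have [h hE] := oy z mz.
    by exists (g + h); rewrite !rmorphD mulrDl gE hE.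
  - by have [g gE] := ox z mz; exists (b * g); rewrite !rmorphM -mulrA gE.
have omE x y : om x -> psi x = psi y -> om y.
  by move=> ox xy z mz; rewrite -xy; apply: ox.
have [U [w [omw omgen]]] := fin_genP noeG idom.
have omP x b : P b -> om x -> exists2 y, om y & psi (f b) * c * psi x = psi y.
  move=> Pb ox; have [e eE] := Pgen b Pb.
  have [t|y yP] := @choice T G (fun t y => om y /\ psi (f (a t)) * c * psi x = psi y).
    have mt : monomial_in bs (psi (f (a t)) * c * 1).
      by apply: monomial_in_mul (monomial_in1 _); apply: map_f; rewrite mem_enum.
    have [g gE] := ox _ mt; rewrite mulr1 in gE; exists g; split; last by rewrite mulrC.
    move=> z mz; have [|h hE] := ox (psi (f (a t)) * c * z).
      by apply: monomial_in_mul => //; apply: map_f; rewrite mem_enum.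
    by exists h; rewrite -gE -mulrA.
  exists (\sum_t f (e t) * y t).
    by apply: ideal_sum => // t _; have [_ _ M] := idom; apply: M; case: (yP t).
  rewrite eE !rmorph_sum !mulr_suml; apply: eq_bigr => t _; rewrite !rmorphM.
  by case: (yP t) => _ <-; rewrite !mulrA.
have [t|u uP] := @choice U G (fun t y => om y /\ psi (f d) * c * psi (w t) = psi y).
  by have [y oy yE] := omP _ _ Pd (omw t); exists y.
apply: contrapT => H.
(* [u t] represents [d c w_t]. If it is not a witness, some [s] outside [P] multiplies it into the
   multiples of [psi (f d)], and cancelling that factor puts [s c w_t] in the image of [psi]. *)
have [t|s sP] := @choice U R (fun t s => ~ P s /\ exists g,
  psi (f s) * c * psi (w t) = psi g).
  apply: contrapT => Hs; apply: H; exists (u t); apply/seteqP; split=> b.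
    move=> Pb; have [y _ yE] := omP _ _ Pb (omw t); exists y => /=.
    by case: (uP t) => _; rewrite rmorphM => <-; rewrite -yE; ring.
  move=> [g]; rewrite rmorphM; case: (uP t) => _ <- E.
  apply: contrapT => nPb; apply: Hs; exists b; split=> //; exists g.
  apply: (mulfI d0); rewrite -E; ring.
pose s0 := \prod_t s t.
have nPs0 : ~ P s0 by apply: prime_prod => // t; case: (sP t).
have omG x : om x -> exists g, psi (f s0) * c * psi x = psi g.
  move=> ox; have [e ->] := omgen x ox.
  have [t|g gP] := @choice U G (fun t g => psi (f s0) * c * psi (w t) = psi g).
    have [_ [g gE]] := sP t; exists (f (\prod_(i | i != t) s i) * g).
    by rewrite /s0 (bigD1 t) //= !rmorphM -gE; ring.
  exists (\sum_t e t * g t); rewrite !rmorph_sum mulr_sumr; apply: eq_bigr => t _.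
  by rewrite !rmorphM -gP; ring.
(* Not only does [s0 c] carry [om] into the image of [psi]: the result is again in [om], as [om]
   absorbs monomials. So the determinant trick applies to [s0 c]. *)
have omS x g : om x -> psi (f s0) * c * psi x = psi g -> om g.
  move=> ox gE z mz; have [y yE] := ox z mz.
  have [|h hE] := omG y; last by exists h; rewrite -hE -gE -yE; ring.
  move=> z' mz'; rewrite -yE -mulrA; apply: ox.
  exact: monomial_inM.
have [t|g gP] := @choice U (U -> G) (fun t e =>
  psi (f s0) * c * psi (w t) = \sum_u psi (e u) * psi (w u)).
  have [g gE] := omG _ (omw t); have [e eE] := omgen g (omS _ _ (omw t) gE).
  by exists e; rewrite gE eE rmorph_sum; apply: eq_bigr => t' _; rewrite rmorphM.
apply: nPs0; rewrite PE /=; apply: (integral_stable gP).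
(* The determinant trick needs a generator of [om] with nonzero image; one exists because
   [f d ^+ (N * K)] lies in [om] and does not map to 0. *)
apply: contrapT => w0; have [e /(congr1 psi)] : exists e,
  f d ^+ (N * K) = \sum_t e t * w t.
  apply: omgen => z /HK[h hE]; exists h; rewrite -hE; congr (_ * _).
  by rewrite !rmorphXn -exprM.
rewrite rmorph_sum big1 => [/eqP|t _]; last first.
  rewrite rmorphM; have [->|wt0] := eqVneq (psi (w t)) 0; first by rewrite mulr0.
  by case: w0; exists t.
by rewrite rmorphXn expf_eq0 (negbTE d0) andbF.
Qed.

End AssPrincipal.

(** * Cancelling linear forms in integral dependence *)

Section OrderFiltration.
Variables (R : comNzRingType) (r : nat).
Implicit Types (F : {mpoly R[r]}) (B : nat).

Definition order_ge B F := forall m, m \in msupp F -> (B <= mdeg m)%N.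

Lemma order_geM B B' F F' : order_ge B F -> order_ge B' F' ->
  order_ge (B + B') (F * F').
Proof.
move=> oF oF' m /msuppM_le/allpairsP[[m1 m2] /= [/oF h1 /oF' h2 ->]].
by rewrite mdegD leq_add.
Qed.

Lemma order_geX m : order_ge (mdeg m) 'X_[m].
Proof. by move=> m'; rewrite msuppX inE => /eqP ->. Qed.

Lemma dhomog_order_ge B d F : (B <= d)%N -> F \is d.-homog -> order_ge B F.
Proof. by move=> Bd /dhomogP hF m /hF ->. Qed.

Lemma submonomial (m : 'X_{1..r}) B : (B <= mdeg m)%N ->
  exists2 k : 'X_{1..r}, (k <= m)%MM & mdeg k = B.
Proof.
elim: B => [_|B IH Bm].
  by exists 0%MM; rewrite ?mdeg0 //; apply/mnm_lepP => i; rewrite mnm0E.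
have [k km kB] := IH (ltnW Bm).
have [i ki] : exists i, (k i < m i)%N.
  apply: contrapT => H; move: Bm; rewrite -kB ltnNge; case/negP.
  rewrite !mdegE; apply: leq_sum => i _; rewrite leqNgt; apply/negP => ki.
  by apply: H; exists i.
exists (k + U_(i))%MM; last by rewrite mdegD kB mdeg1 addn1.
apply/mnm_lepP => j; rewrite mnmDE mnm1E; case: eqP => [<-|_].
  by rewrite addn1.
by rewrite addn0; apply/mnm_lepP.
Qed.

End OrderFiltration.

Section Cancellation.
Variables (R : comNzRingType) (r : nat) (C : idomainType).
Variables (psi : {rmorphism {mpoly R[r]} -> C}).

(* With [B] large, the module generated by the [g ^+ e * Y ^ k], [e <= E],     *)
(* [mdeg k = B], is stable under [g]: by the pigeonhole principle [Y ^ k]      *)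
(* contains a power of some [Y_j] that the equation of [g * Y_j] applies to.   *)
Lemma integral_cancel (g : C) : (exists j, psi 'X_j != 0) ->
  (forall j, exists u (a : nat -> {mpoly R[r]}),
     (forall i, (i < u)%N -> order_ge (u - i) (a i)) /\
     (g * psi 'X_j) ^+ u = \sum_(i < u) psi (a i) * (g * psi 'X_j) ^+ i) ->
  integralOver psi g.
Proof.
move=> [j0 yj0] /choice[u /choice[a aP]].
pose B := (\sum_j u j)%N.
have uB j : (u j <= B)%N by rewrite /B (bigD1 j) //= leq_addr.
pose w (k : 'X_{1..r < B.+1}) : C := if mdeg k == B then psi 'X_[k] else 0.
pose v (t : 'I_B.+1 * 'X_{1..r < B.+1}) := g ^+ t.1 * w t.2.
pose W z := exists b : 'I_B.+1 * 'X_{1..r < B.+1} -> {mpoly R[r]},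
  z = \sum_t psi (b t) * v t.
have W0 : W 0 by exists (fun=> 0); rewrite big1 // => t _; rewrite rmorph0 mul0r.
have WD z z' : W z -> W z' -> W (z + z').
  move=> [b ->] [b' ->]; exists (fun t => b t + b' t); rewrite -big_split;
    apply: eq_bigr => t _.
  by rewrite rmorphD mulrDl.
have WM c z : W z -> W (psi c * z).
  move=> [b ->]; exists (fun t => c * b t); rewrite mulr_sumr; apply: eq_bigr => t _.
  by rewrite rmorphM mulrA.
have Wsum (T : Type) (s : seq T) (f : T -> C) : (forall t, W (f t)) ->
  W (\sum_(t <- s) f t).
  by move=> Wf; elim/big_ind: _.
(* Each monomial of order at least [B] splits off one of degree exactly [B]; the rest goes into the
   coefficient. *)
have Wg e F : (e <= B)%N -> order_ge B F -> W (g ^+ e * psi F).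
  move=> eB oF; rewrite (mpolyE F) rmorph_sum mulr_sumr big_seq.
  elim/big_ind: _ => // m /oF/submonomial[k km kB].
  have kB1 : (mdeg k < B.+1)%N by rewrite kB.
  rewrite -mul_mpolyC rmorphM mulrCA; apply: (WM).
  rewrite -(submK km) mpolyXD rmorphM mulrCA; apply: (WM).
  exists (fun t => (t == (Ordinal (eB : e < B.+1)%N, BMultinom kB1))%:R).
  rewrite (bigD1 (Ordinal (eB : e < B.+1)%N, BMultinom kB1)) //= eqxx rmorph1 mul1r.
  rewrite big1 => [|t /negbTE ->]; last by rewrite rmorph0 mul0r.
  by rewrite addr0 /v /w /= kB eqxx.
have step t : W (g * v t).
  case: t => e k; rewrite /v /w /=; case: eqP => [kB|_]; last by rewrite !mulr0.
  rewrite mulrA -exprS; have [eB|Be] := ltnP e B; first by apply: Wg => // m;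
    rewrite msuppX inE => /eqP ->; rewrite kB.
  have {Be} eB : e = B :> nat by apply/eqP; rewrite eqn_leq Be -ltnS ltn_ord.
  have [j ukj] : exists j, (u j <= k j)%N.
    apply: contrapT => H; have kj j : (k j < u j)%N.
      by rewrite ltnNge; apply/negP => uk; apply: H; exists j.
    move: kB; apply/eqP; rewrite /B mdegE neq_ltn
      (bigD1 j0) //= [X in (_ < X)%N](bigD1 j0) //=.
    apply/orP; left; rewrite -addSn leq_add //; apply: leq_sum => j _; exact: ltnW.
  have [ao aE] := aP j.
  have Ule : (U_(j) *+ u j <= k)%MM.
    apply/mnm_lepP => i; rewrite mulmnE mnm1E; case: eqP => [<-|_];
      by rewrite ?mul1n ?mul0n.
  set rest := (k - U_(j) *+ u j)%MM.
  have restE : (u j + mdeg rest = B)%N.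
    by rewrite -kB -(submK Ule) mdegD mdegMn mdeg1 mul1n addnC.
  (* The equation of [g * Y_j] trades [u j] factors [g] for fewer. Since [a j i] has order at least
     [u j - i], the order in the variables stays at least [B]. *)
  have -> : g ^+ e.+1 * psi 'X_[k] = \sum_(i < u j) g ^+ (e.+1 - u j + i) * psi
    (a j i * 'X_j ^+ i * 'X_[rest]).
    rewrite -(submK Ule) mpolyXD -mpolyXn rmorphM rmorphXn eB.
    have -> : g ^+ B.+1 = g ^+ (B.+1 - u j) * g ^+ u j by rewrite -exprD subnK // leqW.
    transitivity (g ^+ (B.+1 - u j) * psi 'X_[rest] * (g * psi 'X_j) ^+ u j).
      by rewrite exprMn /rest; ring.
    rewrite aE mulr_sumr; apply: eq_bigr => i _.
    by rewrite exprMn exprD !rmorphM rmorphXn; ring.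
  apply: Wsum => i; apply: Wg; first by rewrite eB; move: (uB j) (ltn_ord i); lia.
  have -> : B = (u j - i + i + mdeg rest)%N by rewrite subnK ?restE // ltnW.
  refine (order_geM (order_geM (ao _ (ltn_ord i)) _) (@order_geX _ _ _)).
  by rewrite mpolyXn => m; rewrite msuppX inE => /eqP ->; rewrite mdegMn mdeg1 mul1n.
have [b bE] := choice step.
apply: (integral_stable bE).
have jB : (mdeg (U_(j0) *+ B) < B.+1)%N by rewrite mdegMn mdeg1 mul1n.
exists (ord0, BMultinom jB); rewrite /v /w /= expr0 mul1r mdegMn mdeg1 mul1n eqxx.
by rewrite -mpolyXn rmorphXn expf_neq0.
Qed.

End Cancellation.

(** * Integral closure of powers of linear forms *)

Section Homogeneous.

Lemma dhomog_prod_ord (A : nzRingType) s (I : finType) (f : I -> {mpoly A[s]})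
  (d : I -> nat) :
  (forall i, f i \is (d i).-homog) -> \prod_i f i \is (\sum_i d i).-homog.
Proof.
move=> hf; elim/big_rec2: _ => [|i e p _ hp]; first exact: dhomog1.
exact: dhomogM.
Qed.

Lemma mmap_dhomog (A : comNzRingType) r s (y : 'I_r -> {mpoly A[s]}) d F :
  (forall j, y j \is 1.-homog) -> F \is d.-homog ->
  mmap (@mpolyC s A) y F \is d.-homog.
Proof.
move=> hy /dhomogP hF; rewrite /mmap big_seq; apply: rpred_sum => m /hF md.
have {md} <- : mdeg m = d by [].
rewrite mul_mpolyC; apply: rpredZ; rewrite /mmap1 mdegE.
apply: dhomog_prod_ord => j; rewrite -[X in X.-homog]mul1n; exact: dhomogMn.
Qed.

Lemma map_mpoly_dhomog (A B : nzRingType) (f : {rmorphism A -> B}) s d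
  (F : {mpoly A[s]}) :
  F \is d.-homog -> map_mpoly f F \is d.-homog.
Proof.
move=> /dhomogP hF; apply/dhomogP => m; rewrite mcoeff_msupp mcoeff_map_mpoly => nz.
by apply: hF; rewrite mcoeff_msupp; apply: contra_neq nz => ->; rewrite raddf0.
Qed.

Lemma pihomog_shift (A B : nzRingType) r s (T : {mpoly A[r]} -> {mpoly B[s]}) e :
  T 0 = 0 -> {morph T : F F' / F + F'} ->
  (forall d F, F \is d.-homog -> T F \is (d + e)%N.-homog) ->
  forall d F, pihomog mdeg (d + e) (T F) = T (pihomog mdeg d F).
Proof.
move=> T0 TD Th d F;
  rewrite [in LHS](@pihomog_partitionE _ _ mdeg (maxn (mmeasure mdeg F) d.+1) F)
  ?leq_maxl //.
rewrite (big_morph T TD T0) raddf_sum /=.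
have dm : (d < maxn (mmeasure mdeg F) d.+1)%N by rewrite leq_maxr.
rewrite (bigD1 (Ordinal dm)) //= big1 => [|i id].
  by rewrite addr0 pihomog_dE //; apply: Th; apply: pihomogP.
apply: (@pihomog_ne0 _ _ _ (i + e)%N); last by apply: Th; apply: pihomogP.
by rewrite eqn_add2r.
Qed.

End Homogeneous.

(** * Integral closure tested modulo primes *)

Section NilpotentCoefficients.
Variables (R : comNzRingType) (s : nat).

Lemma coef_ideal (P : set R) : is_ideal P ->
  is_ideal [set h : {mpoly R[s]} | forall m, P h@_m].
Proof.
move=> idP; have [P0 PD PM] := idP; split=> [m|g h Pg Ph m|g h Ph m] /=.
- by rewrite mcoeff0.
- by rewrite mcoeffD; apply: PD.
- by rewrite mcoeffM; apply: ideal_sum => // k _; apply: PM.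
Qed.

(** The factor [z] carries the induction: peeling off one [h] replaces [z] by [z * h], which is
    killed by products of one element of [J] fewer. *)
Lemma nil_coef_exp (J : set R) l (h z : {mpoly R[s]}) :
  (forall f : 'I_l -> R, (forall i, J (f i)) -> (\prod_i f i) *: z = 0) ->
  (forall m, J h@_m) -> z * h ^+ l = 0.
Proof.
move=> Jl Jh; elim: l z Jl => [|l IH] z Jl.
  by have := Jl (fun=> 0); rewrite big_ord0 scale1r expr0 mulr1; apply; case.
rewrite exprS mulrA; apply: IH => f Jf.
rewrite {1}(mpolyE h) mulr_sumr scaler_sumr big1 // => m _.
have := Jl (fun i => if unlift ord_max i is Some j then f j else h@_m).
rewrite big_ord_recr /= unlift_none.
rewrite (eq_bigr f) => [|i _]; last first.
  rewrite (_ : widen_ord _ i = lift ord_max i) ?liftK //.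
  by apply: val_inj; rewrite /= /bump leqNgt ltn_ord.
move=> E; rewrite -scalerAr scalerA scalerAl E ?mul0r // => i.
by case: (unlift _ _).
Qed.

End NilpotentCoefficients.

Section LinearForms.
Variables (R : comNzRingType) (s nx r : nat).
Variables (x : 'I_nx -> {mpoly R[s]}) (y : 'I_r -> {mpoly R[s]}).
Hypotheses (hx : forall k, x k \is 1.-homog) (hy : forall j, y j \is 1.-homog).

Local Notation ev := (mmap (@mpolyC s R)).

(** With [x] the images of generators of [N], this is the embedded [N^n]; with [y] in place of [x],
    it is [M^n]. *)
Definition form_pow n g := exists2 F : {mpoly R[nx]}, F \is n.-homog & g = ev x F.

(** An equation of integral dependence for an element of degree [n]; its coefficients are kept as
    forms in variables, before substitution of [y]. *)
Definition monic_form n u (q : {poly {mpoly R[r]}}) :=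
  [/\ q \is monic, size q = u.+1 & forall k, (k <= u)%N ->
    q`_k \is (n * (u - k)).-homog].

Definition form_closure n g := form_pow n g /\
  exists u q, [/\ (0 < u)%N, monic_form n u q & (map_poly (ev y) q).[g] = 0].

Definition integral_mod (P : set R) n g :=
  exists u q, monic_form n u q /\ forall m, P (map_poly (ev y) q).[g]@_m.

Lemma form_pow_homog n g : form_pow n g -> g \is n.-homog.
Proof. by move=> [F hF ->]; apply: mmap_dhomog. Qed.

Lemma form_powZ n a g : form_pow n g -> form_pow n (a *: g).
Proof.
move=> [F hF ->]; exists (a *: F); first exact: rpredZ.
by rewrite mmapZ mul_mpolyC.
Qed.

Lemma form_powM n n' g g' : form_pow n g -> form_pow n' g' ->
  form_pow (n + n') (g * g').
Proof.
move=> [F hF ->] [F' hF' ->]; exists (F * F'); first exact: dhomogM.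
by rewrite rmorphM.
Qed.

Lemma form_powX k : form_pow 1 (x k).
Proof.
exists 'X_k; last by rewrite mmapX mmap1U.
by rewrite dhomogX /= mdeg1.
Qed.

Lemma monic_formM n u v p q : monic_form n u p -> monic_form n v q ->
  monic_form n (u + v) (p * q).
Proof.
move=> [mp sp hp] [mq sq hq]; split=> [||k kuv]; first exact: rpredM.
  by rewrite size_monicM ?monic_neq0 // sp sq addnS.
rewrite coefM; apply: rpred_sum => i _.
have [ui|iu] := ltnP u i; first by rewrite nth_default ?sp // mul0r rpred0.
have [vj|jv] := ltnP v (k - i); first by rewrite [q`__]nth_default ?sq // mulr0 rpred0.
have -> : (n * (u + v - k) = n * (u - i) + n * (v - (k - i)))%N.
  by rewrite -mulnDr; congr (_ * _)%N; move: (ltn_ord i); lia.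
by apply: dhomogM; [apply: hp|apply: hq].
Qed.

Lemma monic_form1 n : monic_form n 0 1.
Proof.
split=> [||k]; rewrite ?monic1 ?size_poly1 // leqn0 => /eqP ->.
by rewrite coefC eqxx muln0 dhomog1.
Qed.

Lemma monic_formX n : monic_form n 1 'X.
Proof.
split=> [||k]; rewrite ?monicX ?size_polyX // => k1; rewrite coefX.
case: k k1 => [|[|]] //= _; first by rewrite rpred0.
by rewrite subnn muln0 dhomog1.
Qed.

Lemma monic_form_prod n (I : finType) (u : I -> nat) (q : I -> {poly {mpoly R[r]}}) :
  (forall i, monic_form n (u i) (q i)) -> monic_form n (\sum_i u i) (\prod_i q i).
Proof.
move=> H; elim/big_rec2: _ => [|i v p _ hp]; first exact: monic_form1.
exact: monic_formM.
Qed.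

Lemma monic_form_exp n u q k : monic_form n u q -> monic_form n (k * u) (q ^+ k).
Proof.
move=> H; elim: k => [|k IH]; first exact: monic_form1.
by rewrite exprS mulSn; apply: monic_formM.
Qed.

Section Residue.
Variables (P : set R) (K : fieldType) (phi : {rmorphism R -> K}).
Hypothesis phiP : forall a, phi a = 0 <-> P a.

Definition res : {rmorphism {mpoly R[s]} -> {mpoly K[s]}} := map_mpoly phi.
Definition psi : {rmorphism {mpoly R[r]} -> {mpoly K[s]}} := res \o ev y.

Lemma res_eq0 h : res h = 0 <-> forall m, P h@_m.
Proof.
split=> [h0 m|Ph]; last by apply/mpolyP => m; rewrite mcoeff_map_mpoly mcoeff0;
  apply/phiP.
by apply/phiP; rewrite -mcoeff_map_mpoly h0 mcoeff0.
Qed.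

Lemma resZ a h : res (a *: h) = (phi a)%:MP * res h.
Proof. by rewrite /= map_mpolyZ mul_mpolyC. Qed.

Lemma res_horner (q : {poly {mpoly R[r]}}) g :
  res (map_poly (ev y) q).[g] = (map_poly psi q).[res g].
Proof. by rewrite -horner_map -map_poly_comp. Qed.

(** Since [g] is homogeneous of degree [n], the component of degree [n * u] of any monic equation of
    degree [u] is again a monic equation for [g], with coefficients of the required degrees. *)
Lemma integral_modP n g : form_pow n g ->
  (integral_mod P n g <-> integralOver psi (res g)).
Proof.
move=> /form_pow_homog hg; split.
  move=> [u [q [[mq _ _] /res_eq0]]]; rewrite res_horner => q0; exists q => //;
    exact/rootP.
case=> p mp /rootP; pose u := (size p).-1.
have sp : size p = u.+1 by rewrite prednK // size_poly_gt0 monic_neq0.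
pose q := \poly_(k < u.+1) pihomog mdeg (n * (u - k)) p`_k.
have pu : p`_u = 1 by rewrite -(monicP mp) lead_coefE.
have qu : q`_u = 1.
  by rewrite coef_poly ltnSn subnn muln0 pu pihomog_dE // dhomog1.
have sq : size q = u.+1 by rewrite size_poly_eq //= subnn muln0 pu pihomog_dE ?dhomog1
  // oner_neq0.
move=> p0; exists u, q; split.
  split=> //; first by rewrite monicE lead_coefE sq qu.
  by move=> k ku; rewrite coef_poly ltnS ku; apply: pihomogP.
apply/res_eq0; rewrite res_horner.
move: p0; rewrite (horner_map_monic psi _ mp sp) => p0.
have mq : q \is monic by rewrite monicE lead_coefE sq qu.
rewrite (horner_map_monic psi _ mq sq).
have hrg : res g \is n.-homog by apply: map_mpoly_dhomog.
have p0' := congr1 (pihomog mdeg (n * u)) p0;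
  rewrite pihomog0 raddfD raddf_sum /= in p0'.
rewrite -[RHS]p0'; congr (_ + _); last by rewrite pihomog_dE //; apply: dhomogMn.
apply: eq_bigr => k _; rewrite coef_poly ltnS ltnW //.
pose T F := psi F * res g ^+ k.
have -> : (n * u = n * (u - k) + n * k)%N.
  by rewrite -mulnDr subnK // ltnW.
apply/esym; apply: (@pihomog_shift _ _ _ _ T).
- by rewrite /T rmorph0 mul0r.
- by move=> F F'; rewrite /T rmorphD mulrDl.
- move=> d F hF; apply: dhomogM; last exact: dhomogMn.
  by apply: map_mpoly_dhomog; apply: mmap_dhomog.
Qed.

End Residue.

Lemma integral_mod_prime P n g a : is_prime_ideal P -> form_pow n g ->
  integral_mod P n g -> integral_mod P n (a *: g).
Proof.
move=> prP hg; have [K [phi [phiP _]]] := residue_field prP.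
move=> /(integral_modP phiP hg) ig; apply/(integral_modP phiP (form_powZ a hg)).
rewrite resZ; apply: integral_mul => //.
have -> : (phi a)%:MP = psi phi a%:MP by rewrite /psi /= mmapC map_mpolyC.
exact: integral_id.
Qed.

Lemma integral_modM P n n' g g' : is_prime_ideal P -> form_pow n g -> form_pow n' g' ->
  integral_mod P n g -> integral_mod P n' g' -> integral_mod P (n + n') (g * g').
Proof.
move=> prP hg hg'; have [K [phi [phiP _]]] := residue_field prP.
move=> /(integral_modP phiP hg) ig /(integral_modP phiP hg') ig'.
by apply/(integral_modP phiP (form_powM hg hg')); rewrite rmorphM; apply: integral_mul.
Qed.

Lemma integral_mod0 P n g : is_prime_ideal P -> (forall m, P g@_m) ->
  integral_mod P n g.
Proof.
by move=> prP Pg; exists 1%N, 'X; split; [apply: monic_formX|rewrite map_polyX hornerX].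
Qed.

Section Closure.
Variables (l : nat) (p : 'I_l -> set R).
Hypothesis prp : forall i, is_prime_ideal (p i).
Hypothesis pnil : exists k, forall f : 'I_k -> R, (forall i j, p j (f i)) ->
  \prod_i f i = 0.

(** Multiply the equations found modulo each [p i]: the value at [g] has coefficients in every
    [p i], so a power of it vanishes. *)
Lemma form_closureP n g : form_closure n g <->
  form_pow n g /\ forall i, integral_mod (p i) n g.
Proof.
split=> [[hg [u [q [u0 mq qg]]]]|[hg /choice[u /choice[q qP]]]].
  split=> // i; exists u, q; split=> // m; rewrite qg mcoeff0.
  by have [[]] := prp i.
split=> //; have [k kP] := pnil.
(* The extra factor ['X] makes the degree positive. *)
pose Q := \prod_i q i; exists (k * (\sum_i u i) + 1)%N, (Q ^+ k * 'X); split;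
  first by rewrite addn1.
  apply: monic_formM (monic_formX n); apply: monic_form_exp.
  by apply: monic_form_prod => i; case: (qP i).
rewrite rmorphM rmorphXn /= map_polyX hornerMX horner_exp.
have -> : (map_poly (ev y) Q).[g] ^+ k = 0; last by rewrite mul0r.
rewrite -[LHS]mul1r; apply: (@nil_coef_exp _ _ [set a | forall i, p i a]).
  by move=> f Jf; rewrite kP ?scale0r // => i j; apply: Jf.
move=> m i; rewrite /Q rmorph_prod /= horner_prod (bigD1 i) //=.
have [_ Pi] := qP i; have [idp _ _] := prp i.
exact: (ideal_mulr _ (coef_ideal s idp) Pi).
Qed.

Lemma form_closureZ n a g : form_closure n g -> form_closure n (a *: g).
Proof.
move=> /form_closureP[hg ig]; apply/form_closureP; split; first exact: form_powZ.
by move=> i; apply: integral_mod_prime.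
Qed.

(* [P] is the intersection of these finitely many ideals, hence one of them. *)
Lemma closure_colon P n c : is_prime_ideal P -> form_pow n c ->
  P = [set a | form_closure n (a *: c)] -> exists i,
    P = [set a | integral_mod (p i) n (a *: c)].
Proof.
move=> prP hc PE; have [idP P1 PM] := prP.
apply: contrapT => H.
have [i|a aP] := @choice 'I_l R (fun i a => ~ P a /\ integral_mod (p i) n (a *: c)).
  apply: contrapT => Hi; apply: H; exists i; apply/seteqP; split=> a.
    by rewrite PE => /form_closureP[_]; apply.
  by move=> ia; apply: contrapT => nPa; apply: Hi; exists a.
have : ~ P (\prod_i a i) by apply: prime_prod => // i; case: (aP i).
apply; rewrite PE; apply/form_closureP; split=> [|i]; first exact: form_powZ.
rewrite (bigD1 i) //= mulrC -scalerA; apply: integral_mod_prime => //;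
  first exact: form_powZ.
by case: (aP i).
Qed.

End Closure.
End LinearForms.

Arguments res : simpl never.
Arguments psi : simpl never.

(** * From degree n to degree n + 1 *)

Section Persistence.
Variables (R : comNzRingType) (s nx r : nat).
Variables (x : 'I_nx -> {mpoly R[s]}) (y : 'I_r -> {mpoly R[s]}).
Hypotheses (hx : forall k, x k \is 1.-homog) (hy : forall j, y j \is 1.-homog).
Hypothesis hyx : forall j, form_pow x 1 (y j).

Local Notation ev := (mmap (@mpolyC s R)).

Lemma mmap_vanish (S : comNzRingType) (f : {rmorphism {mpoly R[s]} -> S}) t
  (z : 'I_t -> {mpoly R[s]})
    d (F : {mpoly R[t]}) : (0 < d)%N -> (forall k, f (z k) = 0) -> F \is d.-homog ->
      f (ev z F) = 0.
Proof.
move=> d0 fz /dhomogP hF; rewrite /mmap rmorph_sum big_seq big1 // => m /hF md.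
rewrite rmorphM rmorph_prod.
have [k k0] : exists k, (0 < m k)%N.
  apply: contrapT => H; have : mdeg m = d by [].
  rewrite mdegE big1 => [d0'|k _]; first by rewrite -d0' in d0.
  by apply/eqP; rewrite -leqn0 leqNgt; apply/negP => k0; apply: H; exists k.
by rewrite (bigD1 k) //= rmorphXn fz expr0n gtn_eqF // mul0r mulr0.
Qed.

Variables (l : nat) (p : 'I_l -> set R).
Hypothesis prp : forall i, is_prime_ideal (p i).
Hypothesis pnil : exists k, forall f : 'I_k -> R, (forall i j, p j (f i)) ->
  \prod_i f i = 0.
Hypothesis pmin : forall i j, p i `<=` p j -> i = j.

Lemma closure_ass_step P n c : is_prime_ideal P -> (0 < n)%N -> form_pow x n c ->
  P = [set a | form_closure x y n (a *: c)] ->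
  exists2 c', form_pow x n.+1 c' & P = [set a | form_closure x y n.+1 (a *: c')].
Proof.
move=> prP n0 hc PE; have [idP P1 PM] := prP.
have [i Pi] := closure_colon hx hy prp pnil prP hc PE.
have [K [phi [phiP _]]] := residue_field (prp i).
have CP := form_closureP x y prp pnil.
have [[j0 yj0]|y0] := pselect (exists j, res s phi (y j) != 0).
(* If no [c * y j] has annihilator [P], a product [a0] of elements outside [P] carries all of them
   into the closure; cancelling the [y j] makes [a0 *: c] integral modulo [p i], which puts [a0] in
   [P]. *)
- apply: contrapT => H.
  have hcy j : form_pow x n.+1 (c * y j) by rewrite -addn1; apply: form_powM.
  have [j|a aP] := @choice 'I_r R (fun j a => ~ P a /\
    form_closure x y n.+1 (a *: (c * y j))).
    apply: contrapT => Hj; apply: H; exists (c * y j) => //; apply/seteqP; split=> a.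
      rewrite {1}PE => /CP[_ ia]; apply/CP; split; first exact: form_powZ.
      move=> i'; rewrite scalerAl -addn1; apply: (integral_modM hx hy) => //;
        first exact: form_powZ.
      have [K' [phi' [phiP' _]]] := residue_field (prp i').
      apply/(integral_modP hx hy phiP') => //.
      have -> : res s phi' (y j) = psi y phi' 'X_j by rewrite /psi /= mmapX mmap1U.
      exact: integral_id.
    by move=> ia; apply: contrapT => nPa; apply: Hj; exists a.
  have : ~ P (\prod_j a j) by apply: prime_prod => // j; case: (aP j).
  apply; rewrite Pi; set a0 := \prod_j a j.
  apply/(integral_modP hx hy phiP); first exact: form_powZ.
  apply: integral_cancel; first by exists j0; rewrite /psi /= mmapX mmap1U.
  move=> j.
  have /CP[_ /(_ i)] : form_closure x y n.+1 (a0 *: (c * y j)).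
    rewrite /a0 (bigD1 j) //= mulrC -scalerA; apply: (form_closureZ hx hy prp pnil).
    by case: (aP j).
  move=> [u [q [[mq sq hq] /(res_eq0 phiP)]]]; rewrite res_horner.
  have -> : res s phi (a0 *: (c * y j)) = res s phi (a0 *: c) * psi y phi 'X_j.
    by rewrite scalerAl rmorphM /psi /= mmapX mmap1U.
  rewrite (horner_map_monic _ _ mq sq) => /eqP; rewrite addrC addr_eq0 => /eqP qE.
  (* The coefficient has degree [n.+1 * (u - k)], at least the order [u - k] that cancellation asks
     for. *)
  exists u, (fun k => - q`_k); split=> [k ku|].
    have hk := hq k (ltnW ku); apply: (@dhomog_order_ge _ _ _ (n.+1 * (u - k)));
      first by rewrite mulSn leq_addr.
    by rewrite rpredN.
  by rewrite qE -sumrN; apply: eq_bigr => k _; rewrite rmorphN mulNr.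
have {}y0 j : res s phi (y j) = 0.
  by apply/eqP; apply: contrapT => yj; apply: y0; exists j; apply/negP.
(* All coefficients of positive degree vanish here, so being integral means having a zero power in a
   domain. *)
have intE m g : (0 < m)%N -> integral_mod y (p i) m g <-> res s phi g = 0.
  move=> m0; split=> [[u [q [[mq sq hq] /(res_eq0 phiP)]]]|/(res_eq0 phiP)];
    last exact: integral_mod0.
  rewrite res_horner (horner_map_monic _ _ mq sq) big1 => [|k _].
    by rewrite add0r => /eqP; rewrite expf_eq0 => /andP[_ /eqP].
  rewrite /psi /= (@mmap_vanish _ (res s phi) _ _ (m * (u - k))) ?mul0r //.
    by rewrite muln_gt0 m0 subn_gt0 ltn_ord.
  by apply: hq; apply: ltnW.
have {}PE' a : P a <-> phi a = 0.
  have c0 : res s phi c != 0.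
    apply/eqP => c0; apply: P1; rewrite Pi /=; apply/intE => //.
    by rewrite resZ c0 mulr0.
  rewrite Pi /=; split=> [/(intE _ _ n0)/eqP|a0].
    by rewrite resZ mulf_eq0 (negbTE c0) orbF mpolyC_eq0 => /eqP.
  by apply/intE => //; rewrite resZ a0 mpolyC0 mul0r.
have c0 : res s phi c != 0.
  apply/eqP => c0; apply: P1; rewrite Pi /=; apply/intE => //.
  by rewrite resZ c0 mulr0.
have [k xk0] : exists k, res s phi (x k) != 0.
  apply: contrapT => H; case/eqP: c0; have [F hF ->] := hc.
  apply: (mmap_vanish n0) hF => k; apply/eqP; apply: contrapT => xk; apply: H.
  by exists k; apply/negP.
(* Incomparability gives elements of [p j] outside [p i]; their product [b0] makes the conditions at
   the other primes automatic without affecting the one at [p i]. *)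
have [j|b bP] := @choice 'I_l R (fun j b => j != i -> p j b /\ ~ p i b).
  have [->|ji] := eqVneq j i; first by exists 0.
  apply: contrapT => H; case/eqP: ji; apply: pmin => b pb; apply: contrapT => nb.
  by apply: H; exists b.
pose b0 := \prod_(j | j != i) b j.
have b0i : phi b0 != 0.
  by rewrite rmorph_prod; apply/prodf_neq0 => j /bP[_ nb]; apply/eqP => /phiP.
exists (b0 *: (c * x k)).
  by apply: form_powZ; rewrite -addn1; apply: form_powM => //; apply: form_powX.
apply/seteqP; split=> a.
  move=> /PE' a0; apply/CP; split.
    by do 2!apply: form_powZ; rewrite -addn1; apply: form_powM => //; apply: form_powX.
  move=> j; apply: integral_mod0 => // m; rewrite scalerA mcoeffZ.
  have [idj _ _] := prp j; have [_ _ jM] := idj.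
  rewrite mulrC; apply: (jM); have [->|ji] := eqVneq j i.
    by apply/phiP; rewrite rmorphM a0 mul0r.
  by apply: (jM); rewrite /b0 (bigD1 j) //=; apply: ideal_mulr => //; case: (bP j ji).
move=> /CP[_ /(_ i)/(intE _ _ (ltn0Sn _))/eqP]; rewrite scalerA resZ.
have -> : res s phi (c * x k) = res s phi c * res s phi (x k) by apply: rmorphM.
have -> : phi (a * b0) = phi a * phi b0 by apply: rmorphM.
rewrite !mulf_eq0 (negbTE c0) (negbTE xk0) !orbF mpolyC_eq0 mulf_eq0 (negbTE b0i) orbF.
by move=> /eqP/PE'.
Qed.

End Persistence.

(** * Integral polynomials and linear forms *)

Section ConstantCriterion.
Variables (G : comNzRingType) (C : idomainType) (f : {rmorphism G -> C}).

(** Substituting a nonconstant [h] into a monic polynomial with constant coefficients multiplies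
    degrees, so the result cannot be 0. *)
Lemma integral_polyC_const (h : {poly C}) :
  integralOver (polyC \o f) h -> (size h <= 1)%N.
Proof.
case=> p mp; rewrite map_poly_comp => /rootP.
rewrite -[X in X = 0]/(comp_poly h (map_poly f p)) => p0.
have := size_comp_poly (map_poly f p) h; rewrite p0 size_poly0.
have sp : size (map_poly f p) = size p.
  by rewrite size_map_poly_id0 // (monicP mp) rmorph1 oner_neq0.
rewrite sp /= => /esym/eqP; rewrite muln_eq0 => /orP[] /eqP s1; last by move: s1;
  case: (size h) => [|[|]].
have p1 : p = 1.
  have : size p = 1%N by move: s1 (size_poly_gt0 p); rewrite monic_neq0 //;
    case: (size p) => [|[|]].
  by move=> sp1; have := monicP mp; rewrite lead_coefE sp1 /= => p0';
    rewrite (size1_polyC (eq_leq sp1)) p0'.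
by move/eqP: p0; rewrite p1 rmorph1 /comp_poly rmorph1 hornerC oner_eq0.
Qed.

End ConstantCriterion.

Section LinearFormTheory.

Lemma linear_formE (A : nzRingType) s (z : {mpoly A[s]}) :
  z \is 1.-homog -> z = \sum_i z@_U_(i) *: 'X_i.
Proof.
move=> /dhomogP hz; apply/mpolyP => m; rewrite raddf_sum /=.
have [/eqP/mdeg1P[i /eqP ->]|m1] := eqVneq (mdeg m) 1%N.
  rewrite (bigD1 i) //= big1 => [|j ji];
    first by rewrite mcoeffZ mcoeffX eqxx mulr1 addr0.
  rewrite mcoeffZ mcoeffX; case: eqP => [/mnmP/(_ j)|]; rewrite ?mulr0 //.
  by rewrite !mnm1E eqxx eq_sym (negbTE ji).
rewrite memN_msupp_eq0; last by apply/negP => /hz md; case/eqP: m1.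
rewrite big1 // => i _; rewrite mcoeffZ mcoeffX; case: eqP => [mi|]; rewrite ?mulr0 //.
by case/eqP: m1; rewrite -mi mdeg1.
Qed.

Lemma homog_scale (A C : comNzRingType) t (f g : {rmorphism {mpoly A[t]} -> C})
  (delta : C) d F :
  (forall a, f a%:MP = g a%:MP) -> (forall k, delta * f 'X_k = g 'X_k) ->
  F \is d.-homog -> delta ^+ d * f F = g F.
Proof.
move=> fgC fgX /dhomogP hF; rewrite (mpolyE F) !rmorph_sum mulr_sumr big_seq
  [RHS]big_seq.
apply: eq_bigr => m /hF md; have {md} <- : mdeg m = d by [].
rewrite -mul_mpolyC !rmorphM fgC mulrCA; congr (_ * _).
rewrite mpolyXE_id !rmorph_prod mdegE expr_sum -big_split /=; apply: eq_bigr => k _.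
by rewrite !rmorphXn -fgX exprMn.
Qed.

End LinearFormTheory.

(** * Finiteness of the associated primes *)

Section Finiteness.
Variables (R : comNzRingType) (s nx r : nat).
Variables (x : 'I_nx -> {mpoly R[s]}) (y : 'I_r -> {mpoly R[s]}).
Hypotheses (hx : forall k, x k \is 1.-homog) (hy : forall j, y j \is 1.-homog).
Hypothesis noeR : noetherian R.

Section Projection.
Variables (K : fieldType) (phi : {rmorphism R -> K}).

Let Y : 'M[K]_(r, s) := \matrix_(j, i) phi (y j)@_U_(i).
(** Acting on row vectors from the right, this is a projection onto the row space of [Y], the span
    of the residues of the [y j]. *)
Let Pr : 'M[K]_s := pinvmx Y *m Y.
Let lin (v : 'rV[K]_s) : {mpoly K[s]} := \sum_i v ord0 i *: 'X_i.
Let row_of (z : {mpoly R[s]}) : 'rV[K]_s := \row_i phi z@_U_(i).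

Let res_lin z : z \is 1.-homog -> res s phi z = lin (row_of z).
Proof.
move=> hz; rewrite [LHS]linear_formE; last exact: map_mpoly_dhomog.
by apply: eq_bigr => i _; rewrite mcoeff_map_mpoly mxE.
Qed.

Let proj : {rmorphism {mpoly K[s]} -> {mpoly K[s]}} :=
  mmap (@mpolyC s K) (fun i => lin (row i Pr)).
Let shear : {rmorphism {mpoly K[s]} -> {poly {mpoly K[s]}}} :=
  mmap (polyC \o @mpolyC s K) (fun i => (lin (row i Pr))%:P +
    ('X_i - lin (row i Pr))%:P * 'X).

Let lin_sum (T : finType) (c : T -> K) (v : T -> 'rV[K]_s) :
  lin (\sum_t c t *: v t) = \sum_t c t *: lin (v t).
Proof.
rewrite /lin; under [RHS]eq_bigr do rewrite scaler_sumr.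
rewrite exchange_big; apply: eq_bigr => i _.
rewrite summxE scaler_suml; apply: eq_bigr => t _.
by rewrite mxE scalerA.
Qed.

Let proj_lin v : proj (lin v) = lin (v *m Pr).
Proof.
rewrite mulmx_sum_row lin_sum /lin rmorph_sum; apply: eq_bigr => i _.
by rewrite -mul_mpolyC rmorphM /proj /= mmapC mmapX mmap1U mul_mpolyC.
Qed.

Let shear_lin v : shear (lin v) = (proj (lin v))%:P + (lin v - proj (lin v))%:P * 'X.
Proof.
rewrite proj_lin mulmx_sum_row lin_sum /lin !rmorph_sum /=.
rewrite -sumrB rmorph_sum mulr_suml -big_split /=; apply: eq_bigr => i _.
rewrite -!mul_mpolyC rmorphM /shear /= mmapC mmapX mmap1U /= -/(lin _).
by rewrite mulrDr mulrA -!polyCM mulrBr.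
Qed.

Let proj_y j : proj (res s phi (y j)) = res s phi (y j).
Proof.
rewrite res_lin // proj_lin; congr lin.
have -> : row_of (y j) = row j Y by apply/rowP => i; rewrite !mxE.
by rewrite /Pr -row_mul mulmxA mulmxKpV.
Qed.

(* [h = shear h] is constant in the new variable, being integral over forms   *)
(* in the [y_j], which the shear fixes; evaluate at [1] and at [0].           *)
Let proj_integral h : integralOver (psi y phi) h -> proj h = h.
Proof.
move=> /(integral_rmorph shear) ih.
have sh : integralOver (polyC \o psi y phi) (shear h).
  case: ih => p mp /rootP p0; exists p => //; apply/rootP; rewrite -[RHS]p0;
    congr (_.[_]).
  apply: eq_map_poly;
    apply: (@mpoly_rmorph_ext _ _ _ (polyC \o psi y phi) (shear \o psi y phi)) => [c|j].
    by rewrite /= /psi /= mmapC /res /= map_mpolyC /= /shear /= mmapC.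
  rewrite /= /psi /= mmapX mmap1U res_lin // shear_lin -res_lin // proj_y.
  by rewrite subrr polyC0 mul0r addr0.
have /size1_polyC shE := integral_polyC_const sh.
have e0 : horner_eval 0 (shear h) = proj h.
  apply: (@mpoly_rmorph_ext _ _ _ (horner_eval 0 \o shear) proj) => [c|i] /=.
    by rewrite /shear /proj /= !mmapC /horner_eval hornerC.
  rewrite /shear /proj /= !mmapX !mmap1U /horner_eval hornerD hornerMX !hornerC.
  by rewrite mulr0 addr0.
have e1 : horner_eval 1 (shear h) = h.
  apply: (@mpoly_rmorph_ext _ _ _ (horner_eval 1 \o shear) idfun) => [c|i] /=.
    by rewrite /shear /= !mmapC /horner_eval hornerC.
  rewrite /shear /= !mmapX !mmap1U /horner_eval hornerD hornerMX !hornerC.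
  by rewrite mulr1 addrCA subrr addr0.
by rewrite -e0 -[RHS]e1 shE /horner_eval !hornerC.
Qed.

(** Being algebraic over the [y j] forces [c] to be fixed by the projection, so [c] is a form in the
    projected [x k]. These are combinations of the [y j] over [K], and [d] clears their finitely
    many denominators, once per degree. *)
Lemma common_denominator : (forall z, exists a b, phi b != 0 /\ z = phi a / phi b) ->
  exists d, phi d != 0 /\ forall n c, form_pow x n c ->
    (exists2 a, phi a != 0 & integralOver (psi y phi) (res s phi (a *: c))) ->
    exists m, psi y phi d%:MP ^+ n * res s phi c = psi y phi m.
Proof.
move=> fracK.
pose kap (t : 'I_nx * 'I_r) := (row_of (x t.1) *m pinvmx Y) ord0 t.2.
have /choice[a /choice[b abP]] : forall t, exists a b, phi b != 0 /\
  kap t = phi a / phi b.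
  by move=> t; apply: fracK.
pose d := \prod_t b t; exists d; split.
  by rewrite rmorph_prod; apply/prodf_neq0 => t _; case: (abP t).
have psiC c : psi y phi c%:MP = (phi c)%:MP by rewrite /psi /= mmapC /res /= map_mpolyC.
pose L k : {mpoly R[r]} := \sum_j (a (k, j) * \prod_(t | t != (k, j)) b t) *: 'X_j.
have LE k : psi y phi d%:MP * proj (res s phi (x k)) = psi y phi (L k).
  rewrite res_lin // proj_lin /Pr mulmxA mulmx_sum_row lin_sum mulr_sumr /L rmorph_sum.
  apply: eq_bigr => j _; rewrite -mul_mpolyC -[in RHS]mul_mpolyC rmorphM !psiC mulrA
    -mpolyCM; congr (_ * _).
    congr (_%:MP); have [b0 kE] := abP (k, j).
    rewrite -[(_ *m _) _ _]/(kap (k, j)) kE /d (bigD1 (k, j)) //= !rmorphM.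
    by rewrite mulrC -!mulrA; congr (_ * _); rewrite mulrA mulVf ?mul1r.
  have -> : row j Y = row_of (y j) by apply/rowP => i; rewrite !mxE.
  by rewrite -res_lin // /psi /= mmapX mmap1U.
move=> n c [F hF cE] [e e0 ie].
(* The projection fixes the integral element [e *: c] and all scalars; cancel the nonzero residue of
   [e]. *)
have pc : proj (res s phi c) = res s phi c.
  have := proj_integral ie; rewrite resZ rmorphM /proj /= mmapC -/proj => /mulfI; apply.
  by rewrite mpolyC_eq0.
exists (mmap (@mpolyC r R) L F); rewrite -pc cE.
apply: (@homog_scale _ _ _ (proj \o res s phi \o mmap (@mpolyC s R) x)
  (psi y phi \o mmap (@mpolyC r R) L)) hF.
  move=> e'; rewrite -[LHS]/(proj (res s phi (mmap (@mpolyC s R) x e'%:MP))).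
  rewrite -[RHS]/(psi y phi (mmap (@mpolyC r R) L e'%:MP)) !mmapC psiC.
  by rewrite /res /= map_mpolyC /proj /= mmapC.
move=> k; rewrite -[X in _ * X = _]/(proj (res s phi (mmap (@mpolyC s R) x 'X_k))).
by rewrite -[RHS]/(psi y phi (mmap (@mpolyC r R) L 'X_k)) !mmapX !mmap1U LE.
Qed.

End Projection.

(** [P] contains [p]. If it is larger, [c] is integral up to a scalar outside [p], so the common
    denominator [d] lies in [P] and [P] is one of the finitely many primes attached to [d]. The
    extra slot in the list holds [p] itself. *)
Lemma fin_ass_mod (p : set R) : is_prime_ideal p ->
  exists n (L : 'I_n -> set R), forall P m c, is_prime_ideal P -> form_pow x m c ->
    P = [set a | integral_mod y p m (a *: c)] -> exists i, P = L i.
Proof.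
move=> prp; have [K [phi [phiP fracK]]] := residue_field prp.
have [d [d0 dP]] := common_denominator fracK.
have noeG : noetherian {mpoly R[r]} by apply: mpoly_noetherian.
have idI := principal_ideal (psi y phi) d%:MP.
have [n [L LP]] := fin_ass (@mpolyC r R) noeG idI.
exists n.+1, (fun i => if unlift ord0 i is Some j then L j else p) => P m c prP hc PE.
have psiC a : psi y phi a%:MP = (phi a)%:MP by rewrite /psi /= mmapC /res /= map_mpolyC.
have PE' : P = [set a | integralOver (psi y phi) (psi y phi a%:MP * res s phi c)].
  have E a := integral_modP hx hy phiP (form_powZ a hc).
  by rewrite PE; apply: eq_set => a; apply/propext; rewrite psiC -resZ; apply: E.
have pP : p `<=` P.
  move=> a /phiP a0; rewrite PE' /mkset psiC a0 mpolyC0 mul0r; exact: integral0.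
have [Pp|/existsNP[a /not_implyP[Pa npa]]] := pselect (P `<=` p).
  by exists ord0; rewrite unlift_none; apply/seteqP.
have phia : phi a != 0 by apply/eqP => /phiP.
have [|M ME] := dP m c hc.
  by exists a => //; move: Pa; rewrite {1}PE' /mkset resZ psiC.
have Pd : P d.
  apply: (prime_exp (n := m)) => //; rewrite PE' /mkset.
  have -> : psi y phi (d ^+ m)%:MP = psi y phi d%:MP ^+ m by rewrite !rmorphXn.
  by rewrite ME; apply: integral_id.
have pd0 : psi y phi d%:MP != 0 by rewrite psiC mpolyC_eq0.
have [z zE] := ass_principal noeR noeG prP PE' Pd pd0 ME.
have [|i ->] := LP P prP; first by exists z.
by exists (lift ord0 i); rewrite liftK.
Qed.

End Finiteness.

(** * Incomparable primes and nonzero rings *)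

Section MinimalPrimes.
Variables (R : comPzRingType) (noeR : noetherian R).

Definition prime_family l (p : 'I_l -> set R) := (forall i, is_prime_ideal (p i)) /\
  exists k, forall f : 'I_k -> R, (forall i j, p j (f i)) -> \prod_i f i = 0.

(** In a family of least size with nilpotent intersection no member contains another, since the
    larger one could be dropped. *)
Lemma minimal_primes : exists l (p : 'I_l -> set R),
  prime_family p /\ forall i j, p i `<=` p j -> i = j.
Proof.
have [|l0 [p0 [prp0 p0nil]]] := @noetherian_prod_primes R [set 0] noeR.
  by split=> [|u w -> ->|a u ->] //=; rewrite ?addr0 ?mulr0.
have ex : exists l, `[< exists p : 'I_l -> set R, prime_family p >].
  exists l0; apply/asboolP; exists p0; split=> //; exists l0 => f pf.
  by apply: p0nil => i; apply: pf.
case: (ex_minnP ex) => l /asboolP[p pP] lmin; exists l, p; split=> // i j pij.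
have [prp [k kP]] := pP.
apply: contrapT => ij; move: p i j prp kP pP pij ij lmin;
  case: l => [? []//|l] p i j prp kP _ pij ij lmin.
have /lmin : `[< exists p : 'I_l -> set R, prime_family p >]; last by rewrite ltnn.
apply/asboolP; exists (p \o lift j); split=> [t|]; first exact: prp.
exists k => f pf; apply: kP => t j'.
have [j'' ->|->] := unliftP j j'; first exact: pf.
apply: pij; have [i' iE|iE] := unliftP j i; last by case: ij.
by rewrite iE; apply: pf.
Qed.

End MinimalPrimes.

(** An equality of ring structures, rather than an isomorphism, lets [subst] carry modules and
    ideals along. *)
Lemma comPz_nontrivial (A : comPzRingType) : (1 : A) <> 0 ->
  exists A' : comNzRingType, A = A' :> comPzRingType.
Proof.
move=> /eqP A1; pose m := GRing.PzSemiRing_isNonZero.Build A A1.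
exists (HB.pack_for comNzRingType A m).
by destruct A as [T []].
Qed.

(** * Rees algebras as algebras of forms *)

Section SymLift.
Variables (R : comPzRingType) (V : lmodType R) (A : comPzRingType).
Variables (kappa : {rmorphism R -> A}) (f : V -> A).
Hypothesis flin : forall a u v, f (a *: u + v) = kappa a * f u + f v.

Fixpoint sym_expr_lift (e : sym_expr V) : A :=
  match e with
  | SCst a => kappa a
  | SVar x => f x
  | SOpp e => - sym_expr_lift e
  | SAdd e1 e2 => sym_expr_lift e1 + sym_expr_lift e2
  | SMul e1 e2 => sym_expr_lift e1 * sym_expr_lift e2
  end.

Lemma sym_expr_lift_eq e e' : sym_eq e e' -> sym_expr_lift e = sym_expr_lift e'.
Proof.
have f0 : f 0 = 0.
  by have := flin (-1) 0 0; rewrite scaler0 addr0 rmorphN1 mulN1r addNr.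
elim=> /= [||||||||||||||||x y|a x]; try by move=> *; congruence.
- by move=> *; rewrite addrA.
- by move=> *; rewrite addrC.
- by move=> *; rewrite rmorph0 add0r.
- by move=> *; rewrite rmorph0 addNr.
- by move=> *; rewrite mulrA.
- by move=> *; rewrite mulrC.
- by move=> *; rewrite rmorph1 mul1r.
- by move=> *; rewrite mulrDl.
- by move=> *; rewrite rmorphD.
- by move=> *; rewrite rmorphM.
- by rewrite -[x]scale1r flin rmorph1 mul1r scale1r.
- by rewrite -[a *: x]addr0 flin f0 addr0.
Qed.

Definition sym_lift (z : sym V) : A := sym_expr_lift (repr z).

Lemma sym_liftE e : sym_lift (sym_pi e) = sym_expr_lift e.
Proof. by apply: sym_expr_lift_eq; apply: sym_repr_pi. Qed.

Lemma sym_lift_zmod : zmod_morphism sym_lift.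
Proof.
elim/sym_ind_pi=> e; elim/sym_ind_pi=> e'.
have -> : sym_pi e - sym_pi e' = sym_pi (SAdd e (SOpp e')).
  by rewrite -[RHS]sym_addE -sym_oppE.
by rewrite !sym_liftE.
Qed.

Lemma sym_lift_monoid : monoid_morphism sym_lift.
Proof.
split; first by rewrite [LHS](sym_liftE (SCst V 1)) /= rmorph1.
elim/sym_ind_pi=> e; elim/sym_ind_pi=> e'.
by rewrite [X in sym_lift X]sym_mulE !sym_liftE.
Qed.

Lemma sym_lift_var v : sym_lift (sym_var v) = f v.
Proof. exact: sym_liftE. Qed.

Lemma sym_lift_cst a : sym_lift (sym_cst V a) = kappa a.
Proof. exact: sym_liftE. Qed.

(** The existence half of the universal property of the symmetric algebra; [sym_rmorph_ext] is the
    uniqueness half. *)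
Lemma sym_lift_ex : exists T : {rmorphism sym V -> A},
  (forall a, T (sym_cst V a) = kappa a) /\ forall v, T (sym_var v) = f v.
Proof.
pose mz := GRing.isZmodMorphism.Build (sym V) A sym_lift sym_lift_zmod.
pose mm := GRing.isMonoidMorphism.Build (sym V) A sym_lift sym_lift_monoid.
pose T : {rmorphism sym V -> A} := HB.pack sym_lift mz mm.
by exists T; split=> [a|v]; [apply: sym_lift_cst|apply: sym_lift_var].
Qed.

End SymLift.

Lemma sym_rmorph_ext (R : comPzRingType) (V : lmodType R) (A : pzRingType)
  (T T' : {rmorphism sym V -> A}) :
  (forall a, T (sym_cst V a) = T' (sym_cst V a)) ->
  (forall v, T (sym_var v) = T' (sym_var v)) -> T =1 T'.
Proof.
move=> eC eV; elim/sym_ind_pi; elim=> [a|v|e IH|e1 IH1 e2 IH2|e1 IH1 e2 IH2].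
- exact: eC.
- exact: eV.
- by rewrite -sym_oppE; rewrite -[sym_opp _]/(- sym_pi e) !rmorphN IH.
- by rewrite -sym_addE -[sym_add _ _]/(sym_pi e1 + sym_pi e2) !rmorphD IH1 IH2.
- by rewrite -sym_mulE -[sym_mul _ _]/(sym_pi e1 * sym_pi e2) !rmorphM IH1 IH2.
Qed.

(** * Functionals and maps to free modules *)

Section DualGenerators.
Variables (R : comNzRingType) (V : lmodType R) (noeR : noetherian R).

Definition functional (mu : V -> R) := forall a u v, mu (a *: u + v) = a * mu u + mu v.

Lemma functional0 mu : functional mu -> mu 0 = 0.
Proof. by move=> H; have := H (-1) 0 0; rewrite scaler0 addr0 mulN1r addNr. Qed.

Lemma functional_sum mu (T : Type) (s : seq T) (c : T -> R) (v : T -> V) :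
  functional mu ->
  mu (\sum_(t <- s) c t *: v t) = \sum_(t <- s) c t * mu (v t).
Proof.
by move=> H; elim: s => [|t s IH]; rewrite ?big_nil ?functional0 // !big_cons H IH.
Qed.

(** Evaluation at [q] generators of [V] embeds the dual in the Noetherian module of [q]-tuples. *)
Lemma dual_generators : fin_gen V -> exists s (lam : 'I_s -> V -> R),
  (forall i, functional (lam i)) /\
  forall mu, functional mu -> exists c, forall v, mu v = \sum_i c i * lam i v.
Proof.
move=> [q [g gV]].
pose coords (mu : V -> R) : nat -> R := fun j =>
  if insub j is Some j' then mu (g j') else 0.
have cE mu (j : 'I_q) : coords mu j = mu (g j) by rewrite /coords valK.
pose S : set (nat -> R) := [set u | exists2 mu, functional mu & u = coords mu].
have [u v [mu Hmu ->] [nu Hnu ->]||a v [mu Hmu ->]|v [mu Hmu ->] j qj|T [b [bS Sgen]]]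
  :=
  @noetherian_submod _ q S noeR.
- exists (fun z => mu z + nu z).
    by move=> a z w; rewrite Hmu Hnu mulrDr addrACA.
  by apply/funext => j; rewrite /coords; case: insub => // ; rewrite ?addr0.
- exists (fun=> 0); first by move=> a z w; rewrite mulr0 addr0.
  by apply/funext => j; rewrite /coords; case: insub.
- exists (fun z => a * mu z); first by move=> b z w; rewrite Hmu mulrDr mulrCA.
  by apply/funext => j; rewrite /coords; case: insub => //; rewrite mulr0.
- by rewrite /coords insubF // ltnNge qj.
have [t|lam lamP] := @choice T (V -> R) (fun t mu => functional mu /\ b t = coords mu).
  by have [mu Hmu ->] := bS t; exists mu.
exists #|T|, (fun i => lam (enum_val i)); split=> [i|mu Hmu];
  first by case: (lamP (enum_val i)).
have [|c cP] := Sgen (coords mu); first by exists mu.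
exists (fun i => c (enum_val i)) => v.
rewrite -(reindex (fun i : 'I_#|T| => enum_val i) (P := xpredT)
  (F := fun t => c t * lam t v)) /=; last first.
  exact: onW_bij (enum_val_bij T).
have [e ->] := gV v.
rewrite functional_sum //.
under [RHS]eq_bigr => t _.
  have [Hl _] := lamP t; rewrite functional_sum // mulr_sumr.
  over.
rewrite exchange_big; apply: eq_bigr => j _ /=.
rewrite -cE cP mulr_sumr; apply: eq_bigr => t _.
by have [_ ->] := lamP t; rewrite cE mulrCA.
Qed.

End DualGenerators.

Section FreeFactor.
Variables (R : comNzRingType) (V F : lmodType R) (g : {linear V -> F}).
Variables (s : nat) (lam : 'I_s -> V -> R).
Hypothesis lamP : forall mu : V -> R, functional mu ->
  exists c, forall v, mu v = \sum_i c i * lam i v.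

(** The image of [g] lies in the span of finitely many basis vectors, whose coordinate functions are
    functionals on [V] and hence combinations of the [lam i]. *)
Lemma free_factor : fin_gen V -> free_module F ->
  exists h : 'I_s -> F, forall v, g v = \sum_i lam i v *: h i.
Proof.
move=> [q [w wV]] [B [Bspan Bfree]].
have /choice[sb /choice[cb sbP]] := fun j => Bspan (g (w j)).
pose S0 := undup (flatten [seq sb j | j <- enum 'I_q]).
have S0B b : b \in S0 -> B b.
  rewrite mem_undup => /flatten_mapP[j _ bj]; by case: (sbP j) => + _; apply.
pose sp z := exists c : F -> R, z = \sum_(b <- S0) c b *: b.
have sp0 : sp 0 by exists (fun=> 0); rewrite big1 // => b _; rewrite scale0r.
have spD z z' : sp z -> sp z' -> sp (z + z').
  move=> [c ->] [c' ->]; exists (fun b => c b + c' b).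
  by rewrite -big_split; apply: eq_bigr => b _; rewrite scalerDl.
have spZ a z : sp z -> sp (a *: z).
  move=> [c ->]; exists (fun b => a * c b).
  by rewrite scaler_sumr; apply: eq_bigr => b _; rewrite scalerA.
have spb b : b \in S0 -> sp b.
  move=> bS; exists (fun b' => (b' == b)%:R);
    rewrite (big_rem b) //= eqxx scale1r big_seq big1 ?addr0 // => b'.
  by rewrite mem_rem_uniq ?undup_uniq // inE => /andP[/negbTE -> _]; rewrite scale0r.
have spg v : sp (g v).
  have [c ->] := wV v; rewrite linear_sum; elim/big_ind: _ => // j _.
  rewrite linearZ; apply: (spZ); case: (sbP j) => _ ->; rewrite big_seq;
    elim/big_ind: _ => // b bj.
  apply: (spZ); apply: spb; rewrite mem_undup; apply/flatten_mapP; exists j => //.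
  by rewrite mem_enum.
have [C CP] := choice spg.
(* The coordinates [C] were merely chosen; freeness of the basis forces them to be linear. *)
have Cfun b : b \in S0 -> functional (fun v => C v b).
  move=> bS a u v; apply/eqP; rewrite -subr_eq0; apply/eqP.
  apply: (Bfree S0 (fun b => C (a *: u + v) b - (a * C u b + C v b))) => //;
    first exact: undup_uniq.
  under eq_bigr do rewrite scalerBl scalerDl -scalerA.
  by rewrite sumrB big_split /= -scaler_sumr -!CP linearP subrr.
have [b|rho rhoP] := @choice F ('I_s -> R)
  (fun b c => b \in S0 -> forall v, C v b = \sum_i c i * lam i v).
  have [bS|nb] := boolP (b \in S0); last by exists (fun=> 0).
  by have [c cP] := lamP (Cfun b bS); exists c.
exists (fun i => \sum_(b <- S0) rho b i *: b) => v.
rewrite CP; under [RHS]eq_bigr do rewrite scaler_sumr.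
rewrite exchange_big /= big_seq [RHS]big_seq; apply: eq_bigr => b bS.
rewrite rhoP // scaler_suml; apply: eq_bigr => i _.
by rewrite scalerA mulrC.
Qed.

End FreeFactor.

Lemma row_free_module (R : comNzRingType) s : free_module ('rV[R]_s).
Proof.
exists [set b | exists i, b = delta_mx 0 i]; split=> [v|sq c usq sqB sum0 b bs].
  exists [seq delta_mx 0 i | i <- enum 'I_s],
    (fun b => \sum_i v 0 i * (b == delta_mx 0 i)%:R).
  split=> [b /mapP[i _ ->]|]; first by exists i.
  rewrite big_map big_enum /= [LHS]row_sum_delta; apply: eq_bigr => i _; congr (_ *: _).
  rewrite (bigD1 i) //= eqxx mulr1 big1 ?addr0 // => j ji.
  case: eqP => [/matrixP/(_ 0 i)|]; last by rewrite mulr0.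
  by rewrite !mxE !eqxx /= [i == j]eq_sym (negbTE ji) => /eqP; rewrite oner_eq0.
have [i bE] := sqB b bs.
have /matrixP/(_ 0 i) := sum0; rewrite summxE mxE (big_rem b) //= big_seq big1 =>
  [|b' b's].
  by rewrite addr0 bE !mxE !eqxx mulr1.
move: b's; rewrite mem_rem_uniq // inE => /andP[b'b /sqB[j jE]].
rewrite jE !mxE eqxx /=; case: eqP => [ij|_]; last by rewrite mulr0.
by case/eqP: b'b; rewrite jE bE ij.
Qed.

Lemma mpoly_eval_ex (R : comNzRingType) (A : comPzRingType) s
  (kap : {rmorphism R -> A}) (h : 'I_s -> A) :
  (1 : A) <> 0 -> exists E : {rmorphism {mpoly R[s]} -> A},
    (forall a, E a%:MP = kap a) /\ forall i, E 'X_i = h i.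
Proof.
move=> /comPz_nontrivial[A' AE]; subst A.
exists (mmap kap h); split=> [a|i]; first exact: mmapC.
exact: etrans (mmapX _ _ _) (mmap1U _ _).
Qed.

(** * Embedding the Rees algebra in a polynomial ring *)

Section Embedding.
Variables (R : comNzRingType) (V : lmodType R).
Variables (s : nat) (lam : 'I_s -> V -> R).
Hypothesis lam_fun : forall i, functional (lam i).
Hypothesis lamP : forall mu : V -> R, functional mu ->
  exists c, forall v, mu v = \sum_i c i * lam i v.

Definition lam_form (v : V) : {mpoly R[s]} := \sum_i lam i v *: 'X_i.

Lemma lam_form_homog v : lam_form v \is 1.-homog.
Proof.
apply: rpred_sum => i _; apply: rpredZ; by rewrite dhomogX /= mdeg1.
Qed.

Lemma row_form_lift : exists T : {rmorphism sym 'rV[R]_s -> {mpoly R[s]}},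
  (forall a, T (sym_cst _ a) = a%:MP) /\ forall v, T (sym_var v) = \sum_i v 0 i *: 'X_i.
Proof.
apply: (@sym_lift_ex _ _ _ (@mpolyC s R)) => a u v.
rewrite mul_mpolyC scaler_sumr -big_split /=; apply: eq_bigr => i _.
by rewrite !mxE scalerDl scalerA.
Qed.

Lemma lam_lift : exists T : {rmorphism sym V -> {mpoly R[s]}},
  (forall a, T (sym_cst V a) = a%:MP) /\ forall v, T (sym_var v) = lam_form v.
Proof.
apply: (@sym_lift_ex _ _ _ (@mpolyC s R)) => a u v.
rewrite mul_mpolyC scaler_sumr -big_split /=; apply: eq_bigr => i _.
by rewrite lam_fun scalerDl scalerA.
Qed.

Variable T : {rmorphism sym V -> {mpoly R[s]}}.
Hypothesis TC : forall a, T (sym_cst V a) = a%:MP.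
Hypothesis TV : forall v, T (sym_var v) = lam_form v.

(** [T] factors through the symmetric algebra of the free module of rows, by way of all the [lam i]
    at once. *)
Lemma rees_ideal_lam z : rees_ideal z -> T z = 0.
Proof.
move=> Iz; have [T' [T'C T'V]] := row_form_lift.
pose g0f v : 'rV[R]_s := \row_i lam i v.
have g0lin : linear g0f by move=> a u v; apply/rowP => i; rewrite !mxE lam_fun.
pose mg := GRing.isLinear.Build R V 'rV[R]_s *:%R g0f g0lin.
pose g0 : {linear V -> 'rV[R]_s} := HB.pack g0f mg.
have E : T =1 T' \o sym_map g0.
  apply: (@sym_rmorph_ext _ _ _ T (T' \o sym_map g0)) => [a|v] /=.
    by rewrite [sym_map _ _]sym_mapE TC T'C.
  by rewrite sym_map_var TV T'V; apply: eq_bigr => i _; rewrite mxE.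
by rewrite E /= (Iz _ g0 (@row_free_module R s)) rmorph0.
Qed.

(** Conversely, each [g] to a free module factors through the [lam i], so [sym_map g] factors
    through [T]. *)
Lemma lam_rees_ideal z : fin_gen V -> T z = 0 -> rees_ideal z.
Proof.
move=> fgV Tz F g freeF; rewrite /sym_ker /mkset.
have [h hP] := free_factor g lamP fgV freeF.
have [F1|F1] := pselect ((1 : sym F) = 0); first by rewrite -[LHS]mul1r F1 mul0r.
have [kap kapE] : exists kap : {rmorphism R -> sym F}, forall a, kap a = sym_cst F a.
  have zm : zmod_morphism (@sym_cst R F).
    move=> a b; apply: (addIr (sym_cst F b)); by rewrite -sym_cstrD !subrK.
  have mm : monoid_morphism (@sym_cst R F) by split=> // a b; apply: sym_cstrM.
  pose mz := GRing.isZmodMorphism.Build R (sym F) (@sym_cst R F) zm.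
  pose m1 := GRing.isMonoidMorphism.Build R (sym F) (@sym_cst R F) mm.
  pose k : {rmorphism R -> sym F} := HB.pack (@sym_cst R F) mz m1.
  by exists k.
have [E [EC EX]] : exists E : {rmorphism {mpoly R[s]} -> sym F},
    (forall a, E a%:MP = kap a) /\ forall i, E 'X_i = sym_var (h i).
  exact: mpoly_eval_ex.
have H : sym_map g =1 E \o T.
  apply: (@sym_rmorph_ext _ _ _ (sym_map g) (E \o T)) => [a|v] /=.
    by rewrite [LHS]sym_mapE TC EC kapE.
  rewrite sym_map_var TV hP linear_sum rmorph_sum; apply: eq_bigr => i _.
  by rewrite -mul_mpolyC rmorphM EC EX kapE linearZ.
by rewrite H /= Tz rmorph0.
Qed.

End Embedding.

Section DegreeForms.
Variables (R : comNzRingType) (U : lmodType R) (t : nat) (w : 'I_t -> U).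
Hypothesis wU : forall u, exists c : 'I_t -> R, u = \sum_k c k *: w k.
Variables (s : nat) (T : {rmorphism sym U -> {mpoly R[s]}}).
Hypothesis TC : forall a, T (sym_cst U a) = a%:MP.

Local Notation form := (fun k => T (sym_var (w k))).

Lemma sym_deg1 : sym_deg U 0 1.
Proof.
exists 1%N, (fun=> 1), (fun=> fun=> 0).
by rewrite big_ord1 big_ord0 scale1r.
Qed.

Lemma sym_deg0 n : sym_deg U n 0.
Proof. by exists 0%N, (fun=> 0), (fun=> fun=> 0); rewrite big_ord0. Qed.

Lemma sym_degD n z z' : sym_deg U n z -> sym_deg U n z' -> sym_deg U n (z + z').
Proof.
move=> [k [c [v ->]]] [k' [c' [v' ->]]].
exists (k + k')%N, (fun i => match split i with inl i => c i | inr i => c' i end).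
exists (fun i => match split i with inl i => v i | inr i => v' i end).
rewrite big_split_ord /=; congr (_ + _); apply: eq_bigr => i _.
  by rewrite (unsplitK (inl i)).
by rewrite (unsplitK (inr i)).
Qed.

Lemma sym_degZ n a z : sym_deg U n z -> sym_deg U n (a *: z).
Proof.
move=> [k [c [v ->]]]; exists k, (fun i => a * c i), v.
by rewrite scaler_sumr; apply: eq_bigr => i _; rewrite scalerA.
Qed.

Lemma sym_deg_var n u z : sym_deg U n z -> sym_deg U n.+1 (sym_var u * z).
Proof.
move=> [k [c [v ->]]].
exists k, c, (fun i j => if unlift ord0 j is Some j' then v i j' else u).
rewrite mulr_sumr; apply: eq_bigr => i _; rewrite big_ord_recl unlift_none.
rewrite !sym_scaleE mulrCA; congr (_ * (_ * _)); apply: eq_bigr => j _.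
by rewrite liftK.
Qed.

Lemma sym_deg_monomial (m : 'X_{1..t}) :
  sym_deg U (mdeg m) (\prod_k sym_var (w k) ^+ m k).
Proof.
rewrite mdegE; elim/big_rec2: _ => [|k d z _ Hz]; first exact: sym_deg1.
elim: (m k) => [|e IH]; first by rewrite expr0 mul1r.
by rewrite exprS -mulrA addSn; apply: sym_deg_var.
Qed.

Lemma form_pow0 n : form_pow form n 0.
Proof. by exists 0; rewrite ?rpred0 // mmap0. Qed.

Lemma form_powD n g g' : form_pow form n g -> form_pow form n g' ->
  form_pow form n (g + g').
Proof.
by move=> [F hF ->] [F' hF' ->]; exists (F + F'); [apply: rpredD|rewrite rmorphD].
Qed.

Lemma sym_deg_formP n g : (exists2 z, sym_deg U n z & T z = g) <-> form_pow form n g.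
Proof.
have prodT d (u : 'I_d -> U) : form_pow form d (\prod_j T (sym_var (u j))).
  elim: d u => [|d IH] u.
    by rewrite big_ord0; exists 1; rewrite ?dhomog1 // rmorph1.
  rewrite big_ord_recl; apply: (@form_powM _ _ _ _ 1 d); last exact: IH.
  have [e ->] := wU (u ord0); rewrite linear_sum rmorph_sum.
  elim/big_ind: _ => [||l _]; [exact: form_pow0|exact: form_powD|].
  rewrite linearZ /= sym_scaleE rmorphM TC mul_mpolyC; apply: form_powZ.
  exact: (form_powX form l).
split=> [[z [k [c [v ->]]] <-]|[F hF ->]].
  rewrite rmorph_sum; elim/big_ind: _ => [||i _]; [exact: form_pow0|exact: form_powD|].
  rewrite sym_scaleE rmorphM TC mul_mpolyC; apply: form_powZ; rewrite rmorph_prod.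
  exact: prodT.
move: hF => /dhomogP hF.
exists (\sum_(m <- msupp F) F@_m *: \prod_k sym_var (w k) ^+ m k).
  rewrite big_seq; elim/big_ind: _ => [||m /hF md]; [exact: sym_deg0|exact: sym_degD|].
  have {md} <- : mdeg m = n by [].
  by apply: sym_degZ; apply: sym_deg_monomial.
rewrite rmorph_sum; apply: eq_bigr => m _.
rewrite sym_scaleE rmorphM TC; congr (_ * _); rewrite rmorph_prod;
  apply: eq_bigr => k _.
by rewrite rmorphXn.
Qed.

End DegreeForms.

Section Transport.
Variables (R : comNzRingType) (M N : lmodType R) (i : {linear M -> N}).
Hypothesis noeR : noetherian R.
Variables (nx r : nat) (v : 'I_nx -> N) (w : 'I_r -> M).
Hypothesis vN : forall u, exists c : 'I_nx -> R, u = \sum_k c k *: v k.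
Hypothesis wM : forall u, exists c : 'I_r -> R, u = \sum_k c k *: w k.

Lemma rees_forms : exists s (eps : rees N -> {mpoly R[s]}),
  exists (x : 'I_nx -> {mpoly R[s]}) (y : 'I_r -> {mpoly R[s]}),
  [/\ (forall k, x k \is 1.-homog) /\ (forall j, y j \is 1.-homog),
      forall j, form_pow x 1 (y j),
      forall n g, (exists2 z, rees_deg N n z & eps z = g) <-> form_pow x n g,
      forall a z, eps (a *: z) = a *: eps z &
      forall n z, integral_closure i n z <-> form_closure x y n (eps z)].
Proof.
have fgN : fin_gen N by exists nx, v.
have [s [lam [lam_fun lamP]]] := dual_generators noeR fgN.
have [T [TC TV]] := lam_lift lam_fun.
pose eps (z : rees N) := T (rees_repr z).
have epsE z : eps (rees_pi z) = T z.
  apply/eqP; rewrite -subr_eq0 -rmorphB; apply/eqP.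
  exact: (rees_ideal_lam lam_fun TC TV) (rees_repr_pi z).
have eps_inj : injective eps.
  move=> a b; rewrite -[a]rees_reprK -[b]rees_reprK !epsE => E.
  apply/rees_piP; apply: (lam_rees_ideal lamP TC TV) => //.
  by rewrite rmorphB E subrr.
have epsB a b : eps (a - b) = eps a - eps b.
  by rewrite -[a]rees_reprK -[b]rees_reprK -rmorphB !epsE rmorphB.
have eps0 : eps 0 = 0 by rewrite -(subrr (0 : rees N)) epsB subrr.
have epsD a b : eps (a + b) = eps a + eps b.
  by rewrite -[a]rees_reprK -[b]rees_reprK -rmorphD !epsE rmorphD.
have epsM a b : eps (a * b) = eps a * eps b.
  by rewrite -[a]rees_reprK -[b]rees_reprK -rmorphM !epsE rmorphM.
have eps1 : eps 1 = 1 by rewrite -(rmorph1 (@rees_pi R N)) epsE rmorph1.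
have epsX a k : eps (a ^+ k) = eps a ^+ k.
  by elim: k => [|k IH]; rewrite ?expr0 // !exprS epsM IH.
have epsZ a z : eps (a *: z) = a *: eps z.
  by rewrite -[z]rees_reprK -linearZ !epsE sym_scaleE rmorphM TC mul_mpolyC.
pose x k := T (sym_var (v k)).
(* [M^n] is by definition an image in the Rees algebra of [N], so its forms are computed with the
   functionals of [N]. *)
pose TM : {rmorphism sym M -> {mpoly R[s]}} := T \o sym_map i.
have TMC a : TM (sym_cst M a) = a%:MP by rewrite /TM /= [sym_map _ _]sym_mapE TC.
pose y j := TM (sym_var (w j)).
have hx k : x k \is 1.-homog by rewrite /x TV; apply: lam_form_homog.
have hy j : y j \is 1.-homog.
  by rewrite /y /TM /= sym_map_var TV; apply: lam_form_homog.
have degN n g : (exists2 z, rees_deg N n z & eps z = g) <-> form_pow x n g.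
  apply: iff_trans (sym_deg_formP vN TC n g).
  split=> [[_ [z dz <-] <-]|[z dz <-]]; first by exists z => //; rewrite epsE.
  by exists (rees_pi z); [exists z|rewrite epsE].
have degM n g : (exists2 z, rees_pow i n z & eps z = g) <-> form_pow y n g.
  apply: iff_trans (sym_deg_formP wM TMC n g).
  split=> [[_ [_ [z dz <-] <-] <-]|[z dz <-]].
    by exists z => //; rewrite rees_mapE epsE.
  exists (rees_map i (rees_pi z)); last by rewrite rees_mapE epsE.
  by exists (rees_pi z) => //; exists z.
have hyx j : form_pow x 1 (y j).
  apply/(sym_deg_formP vN TC); exists (sym_var (i (w j))); last first.
    by rewrite /y /TM /= sym_map_var.
  exists 1%N, (fun=> 1), (fun=> fun=> i (w j)).
  by rewrite !big_ord1 scale1r.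
exists s, eps, x, y; split=> // n z.
have dz : rees_deg N n z <-> form_pow x n (eps z).
  split=> [dz|]; first by apply/degN; exists z.
  by move=> /degN[z' dz' /eps_inj <-].
have sumE u (m : nat -> {mpoly R[s]}) (g : {mpoly R[s]}) :
    \sum_(1 <= j < u.+1) m j * g ^+ (u - j) = \sum_(k < u) m (u - k)%N * g ^+ k.
  rewrite big_add1 big_mkord (reindex_inj rev_ord_inj); apply: eq_bigr => k _ /=.
  by rewrite subnSK // subKn // ltnW.
have evE (q : {poly {mpoly R[r]}}) u g : q \is monic -> size q = u.+1 ->
    (map_poly (mmap (@mpolyC s R) y) q).[g] =
    \sum_(k < u) mmap (@mpolyC s R) y q`_k * g ^+ k + g ^+ u.
  move=> mq sq; exact: horner_map_monic.
split=> [[/dz dz' [u [m [u0 mP mE]]]]|[/dz dz' [u [q [u0 [mq sq hq] qE]]]]]; split=> //.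
  have [j|F FP] := @choice nat {mpoly R[r]} (fun j F => (1 <= j <= u)%N ->
      F \is (n * j).-homog /\ eps (m j) = mmap (@mpolyC s R) y F).
    have [ju|ju] := boolP (1 <= j <= u)%N; last by exists 0.
    by have /degM[F hF FE] : exists2 z, rees_pow i (n * j) z & eps z = eps (m j);
      [exists (m j) => //; apply: mP|exists F].
  (* [m j] multiplies [g ^+ (u - j)], so the coefficients are reversed and the top one is set to
     1. *)
  pose q : {poly {mpoly R[r]}} := \poly_(k < u.+1)
    (if (k < u)%N then F (u - k)%N else 1).
  have qu : q`_u = 1 by rewrite coef_poly ltnSn ltnn.
  have sq : size q = u.+1 by rewrite size_poly_eq // ltnn oner_neq0.
  have mq : q \is monic by rewrite monicE lead_coefE sq qu.
  exists u, q; split=> //.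
    split=> // k ku; rewrite coef_poly ltnS ku; case: ltnP => uk.
      by have [] := FP (u - k)%N; rewrite ?subn_gt0 ?uk ?leq_subr.
    by rewrite (_ : u - k = 0)%N ?muln0 ?dhomog1 //; apply/eqP.
  rewrite (evE _ u) // -[RHS]eps0 -mE epsD epsX addrC; congr (_ + _).
  rewrite (big_morph eps epsD eps0) (eq_bigr (fun j => eps (m j) * eps z ^+ (u - j))).
    rewrite sumE; apply: eq_bigr => k _; rewrite coef_poly ltnS ltnW // ltn_ord.
    by have [|_ ->] := FP (u - k)%N; rewrite ?subn_gt0 ?ltn_ord ?leq_subr.
  by move=> j _; rewrite epsM epsX.
have [j|m mP] := @choice nat (rees N) (fun j m => (1 <= j <= u)%N ->
    rees_pow i (n * j) m /\ eps m = mmap (@mpolyC s R) y q`_(u - j)).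
  have [/andP[j1 ju]|ju] := boolP (1 <= j <= u)%N; last by exists 0.
  have /degM[m' pm' mE] : form_pow y (n * j) (mmap (@mpolyC s R) y q`_(u - j)).
    by exists q`_(u - j) => //; have := hq (u - j)%N (leq_subr _ _); rewrite subKn.
  by exists m'.
exists u, m; split=> // [j ju|]; first by case: (mP j ju).
apply: eps_inj; rewrite eps0 -qE (evE _ u) // epsD epsX addrC; congr (_ + _).
rewrite (big_morph eps epsD eps0) (eq_bigr (fun j => eps (m j) * eps z ^+ (u - j))).
  rewrite sumE; apply: eq_bigr => k _.
  have [|_ ->] := mP (u - k)%N; first by rewrite subn_gt0 ltn_ord leq_subr.
  by rewrite subKn // ltnW.
by move=> j _; rewrite epsM epsX.
Qed.

End Transport.

Lemma corollary7p7_nontrivial (R : comNzRingType) (M N : lmodType R)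
  (i : {linear M -> N}) :
  noetherian R -> fin_gen M -> fin_gen N ->
  (forall n : nat, (1 <= n)%N ->
     Ass_quot (rees_deg N n) (integral_closure i n) `<=`
     Ass_quot (rees_deg N n.+1) (integral_closure i n.+1)) /\
  (exists n0 : nat, (1 <= n0)%N /\
     forall k : nat,
       Ass_quot (rees_deg N n0) (integral_closure i n0) =
       Ass_quot (rees_deg N (n0 + k)) (integral_closure i (n0 + k))).
Proof.
move=> noeR [r [w wM]] [nx [v vN]].
have [s [eps [x [y [[hx hy] hyx degN epsZ clP]]]]] := rees_forms i noeR vN wM.
have [l [p [[prp pnil] pmin]]] := minimal_primes noeR.
have assP n (P : spec R) : Ass_quot (rees_deg N n) (integral_closure i n) P <->
    exists2 c, form_pow x n c & (P : set R) = [set a | form_closure x y n (a *: c)].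
  have E z : [set a | integral_closure i n (a *: z)] =
    [set a | form_closure x y n (a *: eps z)].
    by apply: eq_set => a; apply/propext; rewrite -epsZ; apply: clP.
  split=> [[z dz PE]|[_ /degN[z dz <-] PE]]; last by exists z; rewrite ?PE ?E.
  by exists (eps z); [apply/degN; exists z|rewrite -E].
have step n : (1 <= n)%N -> Ass_quot (rees_deg N n) (integral_closure i n) `<=`
     Ass_quot (rees_deg N n.+1) (integral_closure i n.+1).
  move=> n1 P /assP[c hc PE]; apply/assP.
  exact: (closure_ass_step hx hy hyx prp pnil pmin (spec_prime P) n1 hc PE).
split=> //.
have mono n k : (1 <= n)%N -> Ass_quot (rees_deg N n) (integral_closure i n) `<=`
     Ass_quot (rees_deg N (n + k)) (integral_closure i (n + k)).
  move=> n1; elim: k => [|k IH]; rewrite ?addn0 // addnS => P /IH.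
  by apply: step; rewrite ltn_addr.
have fam j := cid (fin_ass_mod hx hy noeR (prp j)).
pose f j := sval (fam j); pose L j : 'I_(f j) -> set R := sval (cid (svalP (fam j))).
have LP j : forall P m c, is_prime_ideal P -> form_pow x m c ->
    P = [set a | integral_mod y (p j) m (a *: c)] -> exists t, P = L j t.
  exact: svalP (cid (svalP (fam j))).
have inL n P : Ass_quot (rees_deg N n) (integral_closure i n) P -> exists t :
  {j & 'I_(f j)}, (P : set R) = L (tag t) (tagged t).
  move=> /assP[c hc PE]; have [j Pj] := closure_colon hx hy prp pnil
    (spec_prime P) hc PE.
  by have [t Pt] := LP j P n c (spec_prime P) hc Pj;
    exists (Tagged (fun j => 'I_(f j)) t).
(* [d t] is a degree in which the prime indexed by [t] occurs, with default 0 if there is none. *)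
have [t|d dP] := @choice {j & 'I_(f j)} nat (fun t d => forall n P, (1 <= n)%N ->
    Ass_quot (rees_deg N n) (integral_closure i n) P ->
      (P : set R) = L (tag t) (tagged t) ->
    (1 <= d)%N /\ Ass_quot (rees_deg N d) (integral_closure i d) P).
  have [[d [P [d1 dP PE]]]|H] := pselect (exists d P, [/\ (1 <= d)%N,
     Ass_quot (rees_deg N d) (integral_closure i d) P & (P : set R) = L (tag t)
       (tagged t)]).
    by exists d => n Q n1 _ QE; rewrite (@spec_eq _ Q P) // QE.
  by exists 0%N => n P n1 nP PE; case: H; exists n, P.
(* This exceeds every [d t], so by persistence each prime that ever occurs has occurred; the
   successor keeps it positive. *)
exists (\sum_t d t).+1; split=> // k; apply/seteqP; split=> P; first exact: mono.
move=> aP; have [t PE] := inL _ _ aP.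
have [|d1 aPd] := dP t _ P _ aP PE; first by rewrite addSn.
have dle : (d t <= (\sum_t d t).+1)%N by rewrite (bigD1 t) //= ltnW // ltnS leq_addr.
by rewrite -(subnKC dle); apply: mono.
Qed.

Theorem corollary7p7 (R : comPzRingType) (M N : lmodType R)
    (i : {linear M -> N}) :
  noetherian R -> fin_gen M -> fin_gen N -> injective i ->
  (forall n : nat, (1 <= n)%N ->
     Ass_quot (rees_deg N n) (integral_closure i n) `<=`
     Ass_quot (rees_deg N n.+1) (integral_closure i n.+1)) /\
  (exists n0 : nat, (1 <= n0)%N /\
     forall k : nat,
       Ass_quot (rees_deg N n0) (integral_closure i n0) =
       Ass_quot (rees_deg N (n0 + k)) (integral_closure i (n0 + k))).
Proof.
move=> noeR fgM fgN _.
(* The zero ring has no primes, so all the sets are empty. *)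
have [R1|R1] := pselect ((1 : R) = 0).
  have noP (P : spec R) : False.
    by have [[P0 _ _] P1 _] := spec_prime P; apply: P1; rewrite R1.
  split=> [n _ P|]; first by case: (noP P).
  by exists 1%N; split=> // k; apply/seteqP; split=> P; case: (noP P).
have [A AE] := comPz_nontrivial R1; subst R.
exact: corollary7p7_nontrivial.
Qed.
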